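(* Let $n\ge 4$. If $\mathfrak{H}$ is a complex Osserman Kähler model of dimension $n$ with exactly 2 distinct eigenvalues which does not have constant holomorphic sectional curvature, then $\mathfrak{H}$ is isomorphic to $\mathfrak{C}_\mu^n$ for some $\mu\in\mathbb{R}$.
   Context: An algebraic curvature tensor on a finite-dimensional real vector space $V$ is $A\in\otimes^4V^*$ with $A(x,y,z,w)=-A(y,x,z,w)=A(z,w,x,y)$ (the ''usual $\mathbb{Z}_2$ symmetries'') and $A(x,y,z,w)+A(y,z,x,w)+A(z,x,y,w)=0$. An almost-Hermitian curvature model is $\mathfrak{H}=(V,\langle\cdot,\cdot\rangle,J,A)$ with $\langle\cdot,\cdot\rangle$ a positive definite inner product, $J$ an endomorphism with $J^2=-\mathrm{Id}$ and $\langle Jx,Jy\rangle=\langle x,y\rangle$, and $A$ an algebraic curvature tensor; its dimension is $n=\dim_{\mathbb R}V$. Two such models are isomorphic if there is a linear isometry between the underlying spaces intertwining the $J$'s and pulling back one curvature tensor to the other. The curvature operator $A(x,y)$ is defined by $\langle A(x,y)z,w\rangle=A(x,y,z,w)$; the Jacobi operator is $\mathcal{J}(x):y\mapsto A(y,x)x$. For a unit vector $x$, $\pi_x=\mathrm{Span}\{x,Jx\}$; a complex line is a $2$-dimensional $J$-invariant real subspace $\pi$, and $\mathcal{J}(\pi):=\mathcal{J}(x)+\mathcal{J}(Jx)$ for any unit $x\in\pi$. $\mathfrak{H}$ is a Kähler model if $A(Jx,Jy)=A(x,y)$ for all $x,y$. $\mathfrak{H}$ is complex Osserman if $\mathcal{J}(\pi)$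 commutes with $J$ for every complex line $\pi$ and the eigenvalues (with multiplicities) of $\mathcal{J}(\pi)$ do not depend on $\pi$; these are the eigenvalues of $\mathfrak{H}$. The holomorphic sectional curvature is $s(x)=A(x,Jx,Jx,x)$ for unit $x$; it is constant if $s$ is a constant function on the unit sphere. The model $\mathfrak{C}_\mu^n=(V,\langle\cdot,\cdot\rangle,J,C_\mu^n)$, $n=2m$: fix an orthonormal basis $\{x_1,Jx_1,\dots,x_m,Jx_m\}$ of $V$; the non-zero components of $C=C_\mu^n$ in this basis are determined, modulo the usual $\mathbb{Z}_2$ symmetries, for all $i\neq j$ by $C(x_i,Jx_i,Jx_i,x_i)=\mu$, $C(x_i,x_j,x_j,x_i)=-\frac{\mu}{2}$, $C(Jx_i,x_j,x_j,Jx_i)=\frac{\mu}{2}$, $C(Jx_i,Jx_j,Jx_j,Jx_i)=-\frac{\mu}{2}$, $C(x_i,x_j,Jx_j,Jx_i)=-\frac{\mu}{2}$, $C(x_i,Jx_j,Jx_i,x_j)=\frac{\mu}{2}$, $C(x_i,Jx_i,Jx_j,x_j)=0$; all components not obtained from these vanish. *)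

(* Defs.v *)
From HB Require Import structures.
From mathcomp Require Import all_boot all_order all_algebra.
From mathcomp Require Import boolp classical_sets reals.
From mathcomp Require Import ring lra.

Set Implicit Arguments.
Unset Strict Implicit.
Unset Printing Implicit Defensive.

Import Order.TTheory GRing.Theory Num.Theory.

Local Open Scope ring_scope.

Record ah_model (R : realType) := AHModel {
  space :> vectType R;
  inner : space -> space -> R;
  cstr : 'End(space);
  curv : space -> space -> space -> space -> R;
  inner_scalarl : forall y, scalar (inner^~ y);
  inner_sym : forall x y, inner x y = inner y x;
  inner_posdef : forall x, x != 0 -> 0 < inner x x;
  cstr_sqr : forall x, cstr (cstr x) = - x;
  cstr_isom : forall x y, inner (cstr x) (cstr y) = inner x y;
  curv_scalar1 : forall y z w, scalar (fun x => curv x y z w);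
  curv_scalar2 : forall x z w, scalar (fun y => curv x y z w);
  curv_scalar3 : forall x y w, scalar (fun z => curv x y z w);
  curv_scalar4 : forall x y z, scalar (fun w => curv x y z w);
  curv_asym : forall x y z w, curv x y z w = - curv y x z w;
  curv_pair : forall x y z w, curv x y z w = curv z w x y;
  curv_bianchi : forall x y z w,
    curv x y z w + curv y z x w + curv z x y w = 0
}.

Arguments inner {R a} _ _.
Arguments cstr {R a}.
Arguments curv {R a} _ _ _ _.

Definition mdim (R : realType) (H : ah_model R) : nat := \dim {: H}.

Definition isomorphic (R : realType) (H K : ah_model R) : Prop :=
  exists f : 'Hom(H, K),
    [/\ bijective f,
        forall x y, inner (f x) (f y) = inner x y,
        forall x, f (cstr x) = cstr (f x) &
        forall x y z w, curv (f x) (f y) (f z) (f w) = curv x y z w].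

Section Operators.
Context {R : realType}.
Implicit Types H : ah_model R.

(* The vector representing a linear form with respect to the inner product;
   it is characterized by [rieszP] below. *)
Definition riesz H (phi : H -> R) : H :=
  xget 0 [set v : H | forall w, inner v w = phi w].

(* The operator A(x,y), with <A(x,y)z, w> = A(x,y,z,w); see [curv_opP]. *)
Definition curv_op H (x y : H) : 'End(H) :=
  linfun (fun z => riesz (curv x y z)).

Definition jacobi H (x : H) : 'End(H) := linfun (fun y => curv_op y x x).

Definition unitv H (x : H) : Prop := inner x x = 1.

Definition complex_line H (pi : {vspace H}) : Prop :=
  \dim pi = 2%N /\ (cstr @: pi <= pi)%VS.

(* J(pi) is computed from some unit vector of pi; [cjacobiE] below shows that
   every unit vector of pi gives the same operator. *)
Definition cjacobi H (pi : {vspace H}) : 'End(H) :=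
  let x := xget 0 [set x : H | x \in pi /\ unitv x] in
  jacobi x + jacobi (cstr x).

Definition kahler H : Prop :=
  forall x y : H, curv_op (cstr x) (cstr y) = curv_op x y.

(* J(pi) is self-adjoint, so the multiplicity of an eigenvalue is the dimension
   of its eigenspace (0 for a scalar which is not an eigenvalue). *)
Definition complex_osserman H : Prop :=
  (forall pi : {vspace H}, complex_line pi ->
     (cjacobi pi \o cstr = cstr \o cjacobi pi)%VF) /\
  (forall pi pi' : {vspace H}, complex_line pi -> complex_line pi' ->
     forall a : R, \dim (passmx.leigenspace (cjacobi pi) a) =
                   \dim (passmx.leigenspace (cjacobi pi') a)).

Definition model_eigenvalue H (a : R) : Prop :=
  exists2 pi : {vspace H}, complex_line pi & passmx.leigenvalue (cjacobi pi) a.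

Definition two_eigenvalues H : Prop :=
  exists a b : R, a <> b /\
    forall c, model_eigenvalue H c <-> c = a \/ c = b.

Definition hol_sec H (x : H) : R := curv x (cstr x) (cstr x) x.

Definition const_hol_sec H : Prop :=
  exists c : R, forall x : H, unitv x -> hol_sec x = c.

End Operators.

Section OperatorFacts.
Context {R : realType} (H : ah_model R).
Implicit Types (x y z w : H) (a : R).

Lemma inner_scalarr x : scalar (inner x).
Proof. by move=> a y z; rewrite !(inner_sym x) inner_scalarl. Qed.

Lemma inner0l x : inner (0 : H) x = 0.
Proof.
have := inner_scalarl x (-1) (0 : H) 0.
by rewrite scaler0 addr0 mulN1r addNr.
Qed.

Lemma inner_eq0 x : inner x x = 0 -> x = 0.
Proof.
by move=> h; apply/eqP/negPn/negP => /inner_posdef; rewrite h ltxx.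
Qed.

Lemma inner_inj x y : (forall w, inner x w = inner y w) -> x = y.
Proof.
move=> h; apply/eqP; rewrite -subr_eq0; apply/eqP/inner_eq0.
rewrite -[x - y]addrC -[- y]scaleN1r inner_scalarl h; ring.
Qed.

Lemma rieszP (phi : H -> R) : scalar phi ->
  forall w, inner (riesz phi) w = phi w.
Proof.
move=> lphi; pose b := vbasis {: H}.
have Db v : v = \sum_i coord b i v *: tnth b i.
  by rewrite {1}(coord_vbasis (memvf v)); apply: eq_bigr => i _;
     rewrite (tnth_nth 0).
have linE (psi : H -> R) : scalar psi ->
    forall v, psi v = \sum_i coord b i v * psi (tnth b i).
  move=> lpsi v; rewrite {1}(Db v).
  have psi0 : psi 0 = 0.
    by have := lpsi (-1) 0 0; rewrite scaler0 addr0 mulN1r addNr.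
  apply: (big_rec2 (fun u s => psi u = s)) => // i u s _ <-.
  exact: lpsi.
pose g v : 'rV[R]_(\dim {: H}) := \row_i inner v (tnth b i).
have lg : linear g.
  by move=> a u v; apply/rowP => i; rewrite !mxE inner_scalarl.
pose gl := HB.pack_for {linear H -> 'rV[R]_(\dim {: H})} g
  (GRing.isLinear.Build _ _ _ _ g lg).
pose G := linfun gl.
have GE v i : G v 0 i = inner v (tnth b i) by rewrite /G lfunE /= mxE.
have kG : lker G == 0%VS.
  apply/eqP/vspaceP => v; rewrite memv0 memv_ker; apply/eqP/eqP => [hv|->].
    apply: inner_eq0; rewrite (linE _ (inner_scalarr v)).
    by rewrite big1 // => i _; rewrite -GE hv mxE mulr0.
  by rewrite linear0.
have iG : limg G = fullv.
  apply/eqP; rewrite eqEdim subvf /= limg_dim_eq ?(eqP kG) ?capv0 //.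
  by rewrite dimvf /= [dim _]mul1n.
have [v _ hv] : exists2 v, v \in {: H}%VS & \row_i phi (tnth b i) = G v.
  by apply/memv_imgP; rewrite iG memvf.
apply: (@xgetPex _ 0 [set v : H | forall w, inner v w = phi w]).
exists v => w; rewrite (linE _ (inner_scalarr v)) (linE _ lphi).
by apply: eq_bigr => i _; rewrite -GE -hv mxE.
Qed.

Lemma riesz_curvP x y z w : inner (riesz (curv x y z)) w = curv x y z w.
Proof. by apply: rieszP; apply: curv_scalar4. Qed.

Lemma linfun_linE (f : H -> H) : linear f -> linfun f =1 f.
Proof.
move=> lf; pose fl := HB.pack_for {linear H -> H} f
  (GRing.isLinear.Build _ _ _ _ f lf).
exact: (lfunE fl).
Qed.

Lemma curv_opP x y z w : inner (curv_op x y z) w = curv x y z w.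
Proof.
rewrite /curv_op linfun_linE ?riesz_curvP // => a u v.
by apply: inner_inj => t; rewrite inner_scalarl !riesz_curvP curv_scalar3.
Qed.

Lemma jacobiE x y : jacobi x y = curv_op y x x.
Proof.
rewrite /jacobi linfun_linE // => a u v.
by apply: inner_inj => t; rewrite inner_scalarl !curv_opP curv_scalar1.
Qed.

Lemma jacobiP x y z : inner (jacobi x y) z = curv y x x z.
Proof. by rewrite jacobiE curv_opP. Qed.

Lemma inner_cstr x : inner x (cstr x) = 0.
Proof.
have : inner x (cstr x) = - inner x (cstr x).
  rewrite -{1}cstr_isom cstr_sqr inner_sym -scaleN1r -[_ *: _]addr0.
  by rewrite inner_scalarl inner0l; ring.
lra.
Qed.

Lemma complex_lineP (pi : {vspace H}) x : complex_line pi -> x \in pi ->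
  unitv x -> forall y, y \in pi -> exists a b : R, y = a *: x + b *: cstr x.
Proof.
move=> [dpi Jpi] xpi ux y ypi.
have Jxpi : cstr x \in pi by apply: (subvP Jpi); apply: memv_img.
have x0 : x != 0.
  apply/eqP => x0; move: ux; rewrite /unitv x0 inner0l => /eqP.
  by rewrite eq_sym oner_eq0.
have Jxl : cstr x \notin <[x]>%VS.
  apply/vlineP => -[k hk].
  have : inner (cstr x) (cstr x) = 0.
    rewrite {1}hk -[k *: x]addr0 inner_scalarl inner_cstr mulr0 add0r.
    exact: inner0l.
  by rewrite cstr_isom ux => /eqP; rewrite oner_eq0.
have Epi : (<[x]> + <[cstr x]>)%VS = pi.
  apply/eqP; rewrite eqEdim subv_add -!memvE xpi Jxpi /= dpi.
  rewrite ltnNge; apply/negP => le1.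
  have /eqP E : <[x]>%VS == (<[x]> + <[cstr x]>)%VS.
    by rewrite eqEdim addvSl /= dim_vline x0.
  move/negP: Jxl; apply; rewrite E.
  by apply: (subvP (addvSr _ _)); apply: memv_line.
move: ypi; rewrite -Epi => /memv_addP[_ /vlineP[a ->] [_ /vlineP[b ->] ->]].
by exists a, b.
Qed.

Lemma jacobi_rot x (a b : R) : a ^+ 2 + b ^+ 2 = 1 ->
  jacobi (a *: x + b *: cstr x) + jacobi (cstr (a *: x + b *: cstr x)) =
  jacobi x + jacobi (cstr x).
Proof.
move=> ab1; apply/lfunP => y; apply: inner_inj => w.
rewrite !add_lfunE -[inner (_ + _) w in LHS]mul1r.
have D2 y' (u v z : H) p q : curv y' (p *: u + q *: v) z w =
    p * curv y' u z w + q * curv y' v z w.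
  rewrite curv_scalar2; congr (_ + _); rewrite -[q *: v]addr0 curv_scalar2.
  suff -> : curv y' 0 z w = 0 by rewrite addr0.
  have := curv_scalar2 y' z w (-1) 0 0.
  by rewrite scaler0 addr0 mulN1r addNr.
have D3 y' (u v z : H) p q : curv y' z (p *: u + q *: v) w =
    p * curv y' z u w + q * curv y' z v w.
  rewrite curv_scalar3; congr (_ + _); rewrite -[q *: v]addr0 curv_scalar3.
  suff -> : curv y' z 0 w = 0 by rewrite addr0.
  have := curv_scalar3 y' z w (-1) 0 0.
  by rewrite scaler0 addr0 mulN1r addNr.
have Di (u v : H) : inner (u + v) w = inner u w + inner v w.
  by rewrite -[u]scale1r inner_scalarl mul1r scale1r.
have -> : cstr (a *: x + b *: cstr x) = (- b) *: x + a *: cstr x.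
  by rewrite linearD !linearZ /= cstr_sqr scalerN scaleNr addrC.
rewrite mul1r !Di !jacobiP !D2 !D3.
transitivity ((a ^+ 2 + b ^+ 2) * (curv y x x w + curv y (cstr x) (cstr x) w)).
  ring.
by rewrite ab1 mul1r.
Qed.

Lemma cjacobiE (pi : {vspace H}) x : complex_line pi -> x \in pi ->
  unitv x -> cjacobi pi = jacobi x + jacobi (cstr x).
Proof.
move=> cpi xpi ux; rewrite /cjacobi.
set S := [set x : H | _]%classic; set x0 := xget 0 S.
have [x0pi ux0] : S x0 by apply: xgetPex; exists x.
have [a [b E]] := complex_lineP cpi xpi ux x0pi.
rewrite E jacobi_rot //.
have Dl (u v t : H) p q : inner (p *: u + q *: v) t =
    p * inner u t + q * inner v t.
  rewrite inner_scalarl; congr (_ + _); rewrite -[q *: v]addr0 inner_scalarl.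
  by rewrite inner0l addr0.
move: ux0; rewrite E /unitv Dl !(inner_sym _ (_ + _)) !Dl cstr_isom.
by rewrite ux (inner_sym (cstr x)) inner_cstr => <-; ring.
Qed.

End OperatorFacts.

(* The model C_mu^n with n = 2m. The index (i, false) stands for the basis
   vector x_i and (i, true) for J x_i. *)
Section CModel.
Context {R : realType} (mu : R) (m : nat).

Definition idx : finType := ('I_m * bool)%type.
Definition idx4 : finType := (idx * idx * idx * idx)%type.

Definition ix (i : 'I_m) : idx := (i, false).
Definition iJx (i : 'I_m) : idx := (i, true).

(* A component: a quadruple of indices together with a value. *)
Definition comp := (idx4 * R)%type.

Definition C_diag (i : 'I_m) : seq comp :=
  [:: ((ix i, iJx i, iJx i, ix i), mu)].

Definition C_off (i j : 'I_m) : seq comp :=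
  [:: ((ix i, ix j, ix j, ix i), - (mu / 2));
      ((iJx i, ix j, ix j, iJx i), mu / 2);
      ((iJx i, iJx j, iJx j, iJx i), - (mu / 2));
      ((ix i, ix j, iJx j, iJx i), - (mu / 2));
      ((ix i, iJx j, iJx i, ix j), mu / 2);
      ((ix i, iJx i, iJx j, ix j), 0)].

Definition C_list : seq comp :=
  flatten [seq C_diag i | i <- enum 'I_m] ++
  flatten [seq C_off p.1 p.2 | p <- enum {: 'I_m * 'I_m} & p.1 != p.2].

(* The components obtained from one component by the usual Z_2 symmetries. *)
Definition Z2_orbit (e : comp) : seq comp :=
  let: ((a, b, c, d), v) := e in
  [:: ((a, b, c, d), v); ((b, a, c, d), - v);
      ((a, b, d, c), - v); ((b, a, d, c), v);
      ((c, d, a, b), v); ((c, d, b, a), - v);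
      ((d, c, a, b), - v); ((d, c, b, a), v)].

Definition C_full : seq comp := flatten [seq Z2_orbit e | e <- C_list].

Definition C_comp (a b c d : idx) : R :=
  if [seq e <- C_full | e.1 == (a, b, c, d)] is e :: _ then e.2 else 0.

Definition C_space : vectType R := ('rV[R]_m * 'rV[R]_m)%type.

(* (u, v) stands for \sum_i u_i x_i + \sum_i v_i J x_i. *)
Definition C_coord (a : idx) (x : C_space) : R :=
  if a.2 then x.2 0 a.1 else x.1 0 a.1.

Definition C_basis (a : idx) : C_space :=
  if a.2 then (0, delta_mx 0 a.1) else (delta_mx 0 a.1, 0).

Definition C_inner (x y : C_space) : R := \sum_a C_coord a x * C_coord a y.

Definition C_cstr : 'End(C_space) := linfun (fun x : C_space => (- x.2, x.1)).

Definition C_curv (x y z w : C_space) : R :=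
  \sum_a \sum_b \sum_c \sum_d
    C_comp a b c d * C_coord a x * C_coord b y * C_coord c z * C_coord d w.

(* A closed form of the components. *)
Let q1 (a b : idx) : R :=
  (a.1 == b.1)%:R * (~~ a.2 && ~~ b.2)%:R - (a.1 == b.1)%:R * (a.2 && b.2)%:R.
Let q2 (a b : idx) : R := (a.1 == b.1)%:R * (a.2 (+) b.2)%:R.
Let cl (a b c d : idx) : R := - (mu / 2) *
  (q1 a d * q1 b c - q1 a c * q1 b d + (q2 a d * q2 b c - q2 a c * q2 b d)).

Let q1C a b : q1 a b = q1 b a.
Proof. by rewrite /q1 [a.1 == _]eq_sym [a.2 && _]andbC [~~ a.2 && _]andbC. Qed.
Let q2C a b : q2 a b = q2 b a.
Proof. by rewrite /q2 [a.1 == _]eq_sym addbC. Qed.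

Let cl_asym a b c d : cl a b c d = - cl b a c d.
Proof. by rewrite /cl; ring. Qed.
Let cl_pair a b c d : cl a b c d = cl c d a b.
Proof.
rewrite /cl (q1C c b) (q1C d a) (q1C c a) (q1C d b).
by rewrite (q2C c b) (q2C d a) (q2C c a) (q2C d b); ring.
Qed.
Let cl_asym2 a b c d : cl a b c d = - cl a b d c.
Proof. by rewrite cl_pair cl_asym cl_pair. Qed.
Let cl_bianchi a b c d : cl a b c d + cl b c a d + cl c a b d = 0.
Proof.
rewrite /cl (q1C b a) (q1C c b) (q1C c a) (q2C b a) (q2C c b) (q2C c a).
by ring.
Qed.

Let clE (e : comp) := cl e.1.1.1.1 e.1.1.1.2 e.1.1.2 e.1.2 = e.2.

Let cl_listP e : e \in C_list -> clE e.
Proof.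
rewrite mem_cat => /orP[]/flatten_mapP[].
  move=> i _; rewrite inE => /eqP ->.
  by rewrite /clE /cl /q1 /q2 /= eqxx /=; field.
move=> [i j]; rewrite mem_filter /= => /andP[ij _].
have ji : j != i by rewrite eq_sym.
by rewrite !inE => /or4P[||| /or3P[]] /eqP ->;
   rewrite /clE /cl /q1 /q2 /= ?eqxx ?(negbTE ij) ?(negbTE ji) /=; ring.
Qed.

Let cl_fullP e : e \in C_full -> clE e.
Proof.
move=> /flatten_mapP[[[[[a b] c] d] v] /cl_listP].
rewrite {1}/clE /= => E.
rewrite !inE => /or4P[|||/or4P[||| /orP[]]] /eqP ->; rewrite /clE /= -E.
- by [].
- exact: cl_asym.
- exact: cl_asym2.
- by rewrite cl_asym cl_asym2 opprK.
- exact: cl_pair.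
- by rewrite cl_asym2 -cl_pair.
- by rewrite cl_asym -cl_pair.
- by rewrite cl_asym cl_asym2 opprK -cl_pair.
Qed.

Let supp : seq idx4 := [seq e.1 | e <- C_full].

Let in_diag i q :
  q \in [seq e.1 | e <- flatten [seq Z2_orbit e | e <- C_diag i]] ->
  q \in supp.
Proof.
move=> /mapP[e /flatten_mapP[f fi ef] ->]; apply: map_f.
apply/flatten_mapP; exists f => //.
rewrite mem_cat; apply/orP; left; apply/flatten_mapP.
by exists i => //; rewrite mem_enum.
Qed.

Let in_off i j q : i != j ->
  q \in [seq e.1 | e <- flatten [seq Z2_orbit e | e <- C_off i j]] ->
  q \in supp.
Proof.
move=> ij /mapP[e /flatten_mapP[f fi ef] ->]; apply: map_f.
apply/flatten_mapP; exists f => //.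
rewrite mem_cat; apply/orP; right; apply/flatten_mapP.
by exists (i, j) => //; rewrite mem_filter /= ij mem_enum.
Qed.

Let f1 (s t : bool) : R := if s == t then (-1) ^+ s else 0.
Let f2 (s t : bool) : R := if s == t then 0 else 1.
Let clE2 i j k l s t u v : cl (i, s) (j, t) (k, u) (l, v) = - (mu / 2) *
  (((i == l) && (j == k))%:R * (f1 s v * f1 t u + f2 s v * f2 t u) -
   ((i == k) && (j == l))%:R * (f1 s u * f1 t v + f2 s u * f2 t v)).
Proof.
have q1E (a b : idx) : q1 a b = (a.1 == b.1)%:R * f1 a.2 b.2.
  by rewrite /q1 /f1; case: a b => [? []] [? []] /=; ring.
have q2E (a b : idx) : q2 a b = (a.1 == b.1)%:R * f2 a.2 b.2.
  by rewrite /q2 /f2; case: a b => [? []] [? []] /=; ring.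
by rewrite /cl !q1E !q2E /= -!mulnb !natrM; ring.
Qed.

Local Ltac find_mem := rewrite /=; solve [repeat (rewrite in_cons; apply/orP;
  first [left; apply/eqP; reflexivity | right])].

Let cl_supp a b c d : cl a b c d = 0 \/ (a, b, c, d) \in supp.
Proof.
case: a b c d => [i s] [j t] [k u] [l v]; rewrite clE2.
case: (boolP ((i == l) && (j == k))) => [/andP[/eqP <- /eqP <-]|].
  have [<-|ij] := eqVneq i j; rewrite /= ?mul0r ?subr0 ?mul1r /f1 /f2.
    case: s; case: t; case: u; case: v => /=;
      try (by left; ring);
      right; apply: (@in_diag i); find_mem.
  case: s; case: t; case: u; case: v => /=;
    try (by left; ring); right;
    first [apply: (@in_off i j) => //; find_mem
          | apply: (@in_off j i); [by rewrite eq_sym | find_mem]].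
case: (boolP ((i == k) && (j == l))) => [/andP[/eqP <- /eqP <-]|_ _]; last first.
  by left; rewrite !mul0r subrr mulr0.
have [<-|ij _] := eqVneq i j; first by [].
rewrite /= mul0r sub0r mul1r /f1 /f2.
case: s; case: t; case: u; case: v => /=;
  try (by left; ring); right;
  first [apply: (@in_off i j) => //; find_mem
        | apply: (@in_off j i); [by rewrite eq_sym | find_mem]].
Qed.

Let C_compE a b c d : C_comp a b c d = cl a b c d.
Proof.
rewrite /C_comp; case E: [seq _ <- _ | _] => [|e r].
  have [-> //|/mapP[e eC e1]] := cl_supp a b c d.
  have : e \in [seq e <- C_full | e.1 == (a, b, c, d)].
    by rewrite mem_filter -e1 eqxx.
  by rewrite E.
have : e \in [seq e <- C_full | e.1 == (a, b, c, d)] by rewrite E mem_head.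
by rewrite mem_filter => /andP[/eqP e1 /cl_fullP]; rewrite /clE e1.
Qed.

(* The rule defining [C_comp] is consistent: two entries of [C_full] with the
   same indices have the same value. *)
Lemma C_compP a b c d v : ((a, b, c, d), v) \in C_full -> C_comp a b c d = v.
Proof. by rewrite C_compE => /cl_fullP. Qed.

Lemma C_comp0 a b c d :
  (a, b, c, d) \notin [seq e.1 | e <- C_full] -> C_comp a b c d = 0.
Proof. by rewrite C_compE; have [-> //|->] := cl_supp a b c d. Qed.

Let coord_scalar a : scalar (C_coord a).
Proof. by move=> k u v; rewrite /C_coord; case: a.2; rewrite !mxE. Qed.

Let cstr_linear : linear (fun x : C_space => (- x.2, x.1) : C_space).
Proof.
move=> k [u1 u2] [v1 v2] /=; congr (_, _) => /=.
by rewrite opprD scalerN.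
Qed.

Lemma C_cstrE (x : C_space) : C_cstr x = (- x.2, x.1).
Proof.
pose f (x : C_space) : C_space := (- x.2, x.1).
pose fl := HB.pack_for {linear C_space -> C_space} f
  (GRing.isLinear.Build _ _ _ _ f cstr_linear).
exact: (lfunE fl).
Qed.

Let sum4_scalar (F : idx -> idx -> idx -> idx -> C_space -> R) :
  (forall a b c d, scalar (F a b c d)) ->
  scalar (fun x => \sum_a \sum_b \sum_c \sum_d F a b c d x).
Proof.
move=> lF k u v /=.
do 4! (rewrite mulr_sumr -big_split /=; apply: eq_bigr => ? _).
exact: lF.
Qed.

Let rot3 (F : idx -> idx -> idx -> R) :
  \sum_a \sum_b \sum_c F a b c = \sum_c \sum_a \sum_b F a b c.
Proof.
rewrite [RHS]exchange_big /=; apply: eq_bigr => a _.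
by rewrite exchange_big.
Qed.

Lemma C_inner_scalarl y : scalar (C_inner^~ y).
Proof.
move=> k u v; rewrite /C_inner mulr_sumr -big_split /=.
by apply: eq_bigr => a _; rewrite coord_scalar; ring.
Qed.

Lemma C_inner_sym x y : C_inner x y = C_inner y x.
Proof. by apply: eq_bigr => a _; rewrite mulrC. Qed.

Lemma C_inner_posdef x : x != 0 -> 0 < C_inner x x.
Proof.
have nneg a : 0 <= C_coord a x * C_coord a x by rewrite -expr2 sqr_ge0.
move=> x0; rewrite lt_neqAle sumr_ge0 // andbT eq_sym.
apply: contraNneq x0 => /eqP; rewrite psumr_eq0 // => /allP h.
have {}h a : C_coord a x = 0.
  by have := h a (mem_index_enum _); rewrite mulf_eq0 orbb => /eqP.
case: x h {nneg} => u v h; apply/eqP; congr (_, _); apply/rowP => i.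
  by rewrite mxE; apply: (h (ix i)).
by rewrite mxE; apply: (h (iJx i)).
Qed.

Lemma C_cstr_sqr x : C_cstr (C_cstr x) = - x.
Proof. by rewrite !C_cstrE; case: x. Qed.

Let sum_idx (F : idx -> R) : \sum_a F a = \sum_i (F (ix i) + F (iJx i)).
Proof.
transitivity (\sum_i \sum_s F (i, s)).
  by rewrite pair_bigA; apply: eq_bigr => -[].
by apply: eq_bigr => i _; rewrite big_bool addrC.
Qed.

Lemma C_cstr_isom x y : C_inner (C_cstr x) (C_cstr y) = C_inner x y.
Proof.
rewrite /C_inner !sum_idx; apply: eq_bigr => i _.
by rewrite !C_cstrE /C_coord /= !mxE; ring.
Qed.

Lemma C_curv_scalar1 y z w : scalar (fun x => C_curv x y z w).
Proof.
by apply: sum4_scalar => a b c d k u v; rewrite coord_scalar; ring.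
Qed.

Lemma C_curv_scalar2 x z w : scalar (fun y => C_curv x y z w).
Proof.
by apply: sum4_scalar => a b c d k u v; rewrite coord_scalar; ring.
Qed.

Lemma C_curv_scalar3 x y w : scalar (fun z => C_curv x y z w).
Proof.
by apply: sum4_scalar => a b c d k u v; rewrite coord_scalar; ring.
Qed.

Lemma C_curv_scalar4 x y z : scalar (fun w => C_curv x y z w).
Proof.
by apply: sum4_scalar => a b c d k u v; rewrite coord_scalar; ring.
Qed.

Lemma C_curv_asym x y z w : C_curv x y z w = - C_curv y x z w.
Proof.
rewrite /C_curv [in RHS]exchange_big /=.
do 4! (rewrite -sumrN; apply: eq_bigr => ? _).
by rewrite !C_compE cl_asym; ring.
Qed.

Lemma C_curv_pair x y z w : C_curv x y z w = C_curv z w x y.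
Proof.
rewrite /C_curv pair_bigA [RHS]pair_bigA /=.
under eq_bigr do rewrite pair_bigA.
under [RHS]eq_bigr do rewrite pair_bigA.
rewrite [RHS]exchange_big /=; apply: eq_bigr => -[a b] _.
apply: eq_bigr => -[c d] _ /=.
by rewrite !C_compE cl_pair; ring.
Qed.

Lemma C_curv_bianchi x y z w :
  C_curv x y z w + C_curv y z x w + C_curv z x y w = 0.
Proof.
rewrite /C_curv [X in _ + X + _]rot3 [X in _ + X]rot3 [X in _ + X]rot3.
rewrite -!big_split big1 //= => a _; rewrite -!big_split big1 //= => b _.
rewrite -!big_split big1 //= => c _; rewrite -!big_split big1 //= => d _.
rewrite !C_compE.
transitivity ((cl a b c d + cl b c a d + cl c a b d) *
  (C_coord a x * C_coord b y * C_coord c z * C_coord d w)); first ring.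
by rewrite cl_bianchi mul0r.
Qed.

Definition C_model : ah_model R := AHModel C_inner_scalarl C_inner_sym
  C_inner_posdef C_cstr_sqr C_cstr_isom C_curv_scalar1 C_curv_scalar2
  C_curv_scalar3 C_curv_scalar4 C_curv_asym C_curv_pair C_curv_bianchi.

(* The distinguished basis {x_1, J x_1, ..., x_m, J x_m} is orthonormal, and
   C_mu^n has the prescribed components in it. *)
Let coord_basis a b : C_coord a (C_basis b) = (a == b)%:R.
Proof.
by case: a b => [i []] [j []];
  rewrite /C_coord /C_basis /= ?mxE ?xpair_eqE ?andbT ?andbF ?eqxx.
Qed.

Lemma C_basis_orthonormal a b : C_inner (C_basis a) (C_basis b) = (a == b)%:R.
Proof.
rewrite /C_inner (bigD1 a) //= big1 => [|c ca].
  by rewrite !coord_basis eqxx mul1r addr0.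
by rewrite !coord_basis (negbTE ca) mul0r.
Qed.

Lemma C_basis_cstr i : C_basis (iJx i) = C_cstr (C_basis (ix i)).
Proof. by rewrite C_cstrE /C_basis /= oppr0. Qed.

Lemma C_curv_basis a b c d :
  C_curv (C_basis a) (C_basis b) (C_basis c) (C_basis d) = C_comp a b c d.
Proof.
rewrite /C_curv (bigD1 a) //= (bigD1 b) //= (bigD1 c) //= (bigD1 d) //=.
rewrite !coord_basis !eqxx !mulr1.
rewrite big1 => [|p /negbTE pd]; last by rewrite !coord_basis pd mulr0.
rewrite addr0 big1 => [|p /negbTE pd]; last first.
  by rewrite big1 // => q _; rewrite !coord_basis pd !(mulr0, mul0r).
rewrite addr0 big1 => [|p /negbTE pd]; last first.
  rewrite big1 // => q _; rewrite big1 // => r _.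
  by rewrite !coord_basis pd !(mulr0, mul0r).
rewrite addr0 big1 => [|p /negbTE pd]; last first.
  rewrite big1 // => q _; rewrite big1 // => r _; rewrite big1 // => t _.
  by rewrite !coord_basis pd !(mulr0, mul0r).
by rewrite addr0.
Qed.

Lemma mdim_C_model : mdim C_model = (2 * m)%N.
Proof.
rewrite /mdim dimvf; have -> : dim C_model = (1 * m + 1 * m)%N by [].
by rewrite !mul1n mul2n addnn.
Qed.

End CModel.

(* Main.v *)
(** A Kaehler curvature tensor amounts to a Hermitian form Q on the symmetric
    square of (V, J): the operator J(pi) of the line through a unit vector x is
    H_x, with <H_x y, w> = Re Q(xy, xw), and the holomorphic sectional curvature
    is s(x) = Q(xx, xx). Let a < b be the eigenvalues.

    The first variation of s shows that an extremal unit vector x satisfies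
    H_x x = s(x) x; since s is not constant, its maximum is b and its minimum
    is a. The second variation gives b <= 0 when b has complex multiplicity at
    least 2 and a >= 0 when a has, so one multiplicity is 1; call that
    eigenvalue b from now on (forgetting a < b) and fix a unit vector e with
    H_e e = b e. Let M be the antilinear operator with
    <Mu, w> = Re Q(ee, uw). For u orthogonal to e and Je, comparing H at e + u
    and e - u shows that au + Mu is an eigenvector of H_u for b; replacing u by
    Ju, so are au and Mu. Both span the same complex line unless one vanishes,
    and if a <> 0 then M = 0 on the complement of e, so b = 0 or b = 2a, and
    b = 2a makes s constant. If b = 0, the signs in the second variation show
    that a has multiplicity 1, and the two roles can be exchanged. So a = 0.
    Then M / b is an antilinear isometric involution tau, Q has rank one, and
    an orthonormal basis of the real form fixed by tau identifies the model. *)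

Require Import Defs.
From HB Require Import structures.
From mathcomp Require Import all_boot all_order all_algebra.
From mathcomp Require Import boolp classical_sets reals.
From mathcomp Require Import ring lra.
From mathcomp Require Import topology normedtype derive.

Set Implicit Arguments.
Unset Strict Implicit.
Unset Printing Implicit Defensive.

Import Order.TTheory GRing.Theory Num.Theory numFieldNormedType.Exports.

Local Open Scope ring_scope.

(** * Inner product and complex lines *)

Section InnerProduct.
Context {R : realType} {H : ah_model R}.
Implicit Types (x y z w : H) (k : R).

Lemma scalar_formD (phi : H -> R) x y : scalar phi -> phi (x + y) = phi x + phi y.
Proof. by move=> lphi; have := lphi 1 x y; rewrite scale1r mul1r. Qed.

Lemma scalar_form0 (phi : H -> R) : scalar phi -> phi 0 = 0.
Proof.
by move=> lphi; have := lphi (-1) 0 0; rewrite scaler0 addr0 mulN1r addNr.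
Qed.

Lemma scalar_formZ (phi : H -> R) k x : scalar phi -> phi (k *: x) = k * phi x.
Proof.
by move=> lphi; have := lphi k x 0; rewrite addr0 (scalar_form0 lphi) addr0.
Qed.

Lemma scalar_form_sum (phi : H -> R) (I : finType) (F : I -> H) : scalar phi ->
  phi (\sum_i F i) = \sum_i phi (F i).
Proof.
move=> lphi; apply: (big_morph phi); last exact: scalar_form0.
by move=> x y; apply: scalar_formD.
Qed.

Lemma innerDl x y z : inner (x + y) z = inner x z + inner y z.
Proof. by rewrite (scalar_formD _ _ (inner_scalarl z)). Qed.
Lemma innerZl k x z : inner (k *: x) z = k * inner x z.
Proof. by rewrite (scalar_formZ _ _ (inner_scalarl z)). Qed.
Lemma innerNl x z : inner (- x) z = - inner x z.
Proof. by rewrite -scaleN1r innerZl mulN1r. Qed.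
Lemma innerDr x y z : inner z (x + y) = inner z x + inner z y.
Proof. by rewrite (scalar_formD _ _ (inner_scalarr z)). Qed.
Lemma innerZr k x z : inner z (k *: x) = k * inner z x.
Proof. by rewrite (scalar_formZ _ _ (inner_scalarr z)). Qed.
Lemma innerNr x z : inner z (- x) = - inner z x.
Proof. by rewrite -scaleN1r innerZr mulN1r. Qed.
Lemma inner0r x : inner x 0 = 0.
Proof. by rewrite inner_sym inner0l. Qed.

Definition innerE := (innerDl, innerDr, innerZl, innerZr, innerNl, innerNr,
  @inner0l R H, inner0r).

Lemma inner_ge0 x : 0 <= inner x x.
Proof.
have [->|/inner_posdef/ltW //] := eqVneq x 0; by rewrite inner0l.
Qed.

Lemma inner_neq0 x : x != 0 -> inner x x != 0.
Proof. by move=> /inner_posdef /lt0r_neq0. Qed.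

Lemma innerJ x y : inner (cstr x) y = - inner x (cstr y).
Proof. by rewrite -[in RHS]cstr_isom cstr_sqr innerNr opprK. Qed.

Lemma inner_sub_eq0 x y : inner x x + inner y y = 2 * inner x y -> x = y.
Proof.
move=> h; apply/eqP; rewrite -subr_eq0; apply/eqP/inner_eq0.
by rewrite !innerE (inner_sym y x); lra.
Qed.

Lemma unit_neq0 x : unitv x -> x != 0.
Proof. by apply: contra_eq_neq => ->; rewrite inner0l eq_sym oner_neq0. Qed.

Lemma cstr_inj x y : cstr x = cstr y -> x = y.
Proof. by move=> /(congr1 cstr); rewrite !cstr_sqr => /oppr_inj. Qed.

Lemma normalize x : x != 0 ->
  exists r y, [/\ 0 < r, unitv y, x = r *: y & r ^+ 2 = inner x x].
Proof.
move=> x0; have px := inner_posdef x0.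
have s0 : 0 < Num.sqrt (inner x x) by rewrite sqrtr_gt0.
have sE : Num.sqrt (inner x x) ^+ 2 = inner x x by rewrite sqr_sqrtr ?ltW.
exists (Num.sqrt (inner x x)), ((Num.sqrt (inner x x))^-1 *: x); split => //.
  by rewrite /unitv !innerE -[X in _ * (_ * X)]sE; field; rewrite gt_eqF.
by rewrite scalerA divff ?scale1r // gt_eqF.
Qed.

Definition cspan (e x : H) : Prop :=
  exists al be : R, x = al *: e + be *: cstr e.

Definition corth (e x : H) : Prop := inner e x = 0 /\ inner (cstr e) x = 0.

Lemma corthJ e x : corth e x -> corth e (cstr x).
Proof.
move=> [h1 h2]; split; last by rewrite cstr_isom.
by apply/eqP; rewrite -oppr_eq0 -innerJ h2.
Qed.

Lemma corthD e x y : corth e x -> corth e y -> corth e (x + y).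
Proof. by move=> [h1 h2] [h3 h4]; split; rewrite !innerE; lra. Qed.

Lemma corthZ e k x : corth e x -> corth e (k *: x).
Proof. by move=> [h1 h2]; split; rewrite !innerE ?h1 ?h2 mulr0. Qed.

Lemma csplit e x : unitv e ->
  exists p u, [/\ cspan e p, corth e u & x = p + u].
Proof.
move=> ue; pose p := inner x e *: e + inner x (cstr e) *: cstr e.
exists p, (x - p); split; first by exists (inner x e), (inner x (cstr e)).
  have eJ : inner (cstr e) e = 0 by rewrite inner_sym inner_cstr.
  by split; rewrite /p !innerE ?cstr_isom ?eJ ?inner_cstr ?ue
     ?(inner_sym _ x); ring.
by rewrite addrC subrK.
Qed.

Lemma cstrD x y : cstr (x + y) = cstr x + cstr y. Proof. exact: linearD. Qed.
Lemma cstrZ k x : cstr (k *: x) = k *: cstr x. Proof. exact: linearZ. Qed.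
Lemma cstrN x : cstr (- x) = - cstr x. Proof. exact: linearN. Qed.

End InnerProduct.

(** * The Hermitian form of a Kaehler model *)

Section KahlerForm.
Context {R : realType} {H : ah_model R}.
Implicit Types (x y z w : H) (k : R).

(* For a Kaehler model [kform x y z w] is the real part of Q(xy, zw), where Q
   is a Hermitian form on the symmetric square of the complex space (H, J). *)
Definition kform x y z w : R := curv y z x w + curv y (cstr z) (cstr x) w.

(* J(pi) for the complex line pi through [x], when [x] is a unit vector. *)
Definition hop x : 'End(H) := jacobi x + jacobi (cstr x).

Lemma hopP x y w : inner (hop x y) w = kform x y x w.
Proof. by rewrite /hop add_lfunE innerDl !jacobiP. Qed.

Lemma curv0 x z w : curv x x z w = 0.
Proof. by have := curv_asym x x z w; lra. Qed.

Lemma hol_secE x : hol_sec x = kform x x x x.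
Proof. by rewrite /kform curv0 add0r. Qed.

Lemma curv_asym2 x y z w : curv x y z w = - curv x y w z.
Proof. by rewrite curv_pair curv_asym curv_pair. Qed.

Lemma kform_pair x y z w : kform x y z w = kform z w x y.
Proof.
rewrite /kform; congr (_ + _); rewrite curv_pair curv_asym curv_asym2 opprK //.
Qed.

Lemma kform_scalar1 y z w : scalar (fun x => kform x y z w).
Proof.
move=> k u v; rewrite /kform cstrD cstrZ curv_scalar3 curv_scalar3.
by ring.
Qed.

Lemma kform_scalar2 x z w : scalar (fun y => kform x y z w).
Proof. by move=> k u v; rewrite /kform !curv_scalar1; ring. Qed.

Lemma kformD1 x x' y z w : kform (x + x') y z w = kform x y z w + kform x' y z w.
Proof. by rewrite (scalar_formD _ _ (kform_scalar1 y z w)). Qed.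
Lemma kformD2 x x' y z w : kform y (x + x') z w = kform y x z w + kform y x' z w.
Proof. by rewrite (scalar_formD _ _ (kform_scalar2 y z w)). Qed.
Lemma kformD3 x x' y z w : kform y z (x + x') w = kform y z x w + kform y z x' w.
Proof. by rewrite !(kform_pair y) kformD1. Qed.
Lemma kformD4 x x' y z w : kform y z w (x + x') = kform y z w x + kform y z w x'.
Proof. by rewrite !(kform_pair y) kformD2. Qed.
Lemma kformZ1 k x y z w : kform (k *: x) y z w = k * kform x y z w.
Proof. by rewrite (scalar_formZ _ _ (kform_scalar1 y z w)). Qed.
Lemma kformZ2 k x y z w : kform y (k *: x) z w = k * kform y x z w.
Proof. by rewrite (scalar_formZ _ _ (kform_scalar2 y z w)). Qed.
Lemma kformZ3 k x y z w : kform y z (k *: x) w = k * kform y z x w.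
Proof. by rewrite !(kform_pair y) kformZ1. Qed.
Lemma kformZ4 k x y z w : kform y z w (k *: x) = k * kform y z w x.
Proof. by rewrite !(kform_pair y) kformZ2. Qed.
Lemma kformN1 x y z w : kform (- x) y z w = - kform x y z w.
Proof. by rewrite -scaleN1r kformZ1 mulN1r. Qed.
Lemma kformN2 x y z w : kform y (- x) z w = - kform y x z w.
Proof. by rewrite -scaleN1r kformZ2 mulN1r. Qed.
Lemma kformN3 x y z w : kform y z (- x) w = - kform y z x w.
Proof. by rewrite -scaleN1r kformZ3 mulN1r. Qed.
Lemma kformN4 x y z w : kform y z w (- x) = - kform y z w x.
Proof. by rewrite -scaleN1r kformZ4 mulN1r. Qed.

Definition kformE := (kformD1, kformD2, kformD3, kformD4, kformZ1, kformZ2,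
  kformZ3, kformZ4, kformN1, kformN2, kformN3, kformN4).

Lemma hopC x y w : inner (hop x y) w = inner y (hop x w).
Proof. by rewrite [RHS]inner_sym !hopP kform_pair. Qed.

Lemma hopZ k x y : hop (k *: x) y = k ^+ 2 *: hop x y.
Proof.
by apply: inner_inj => w; rewrite innerZl !hopP !kformE; ring.
Qed.

Context (hK : kahler H).

Lemma curvJJ x y z w : curv (cstr x) (cstr y) z w = curv x y z w.
Proof. by rewrite -!curv_opP hK. Qed.

Lemma curvNl x y z w : curv (- x) y z w = - curv x y z w.
Proof. by rewrite -scaleN1r (scalar_formZ _ _ (curv_scalar1 y z w)) mulN1r. Qed.
Lemma curvNr x y z w : curv x (- y) z w = - curv x y z w.
Proof. by rewrite curv_asym curvNl -curv_asym. Qed.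

Lemma curvN3 x y z w : curv x y (- z) w = - curv x y z w.
Proof. by rewrite curv_pair curvNl curv_pair. Qed.

Lemma curvJ x y z w : curv (cstr x) y z w = - curv x (cstr y) z w.
Proof. by rewrite -[in RHS]curvJJ cstr_sqr curvNr opprK. Qed.

Lemma curvJr x y z w : curv x y (cstr z) w = - curv x y z (cstr w).
Proof. by rewrite curv_pair curvJ curv_pair. Qed.

(** Subtract the Bianchi identity at (Jx, Jy, z) from the one at (x, y, z): the terms A(x,y,z,w) and
    A(Jx,Jy,z,w) cancel by the Kaehler condition. *)
Lemma kformC12 x y z w : kform x y z w = kform y x z w.
Proof.
have B1 := curv_bianchi x y z w.
have B2 := curv_bianchi (cstr x) (cstr y) z w.
have E1 := curv_asym z x y w.
have E2 : curv z (cstr x) (cstr y) w = curv x (cstr z) (cstr y) w.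
  by rewrite curv_asym curvJ opprK.
have E3 := curvJ y z (cstr x) w.
by move: B1 B2; rewrite /kform curvJJ E1 E2 E3; lra.
Qed.

Lemma kformC34 x y z w : kform x y z w = kform x y w z.
Proof. by rewrite kform_pair kformC12 kform_pair. Qed.

Lemma kformJ12 x y z w : kform (cstr x) y z w = kform x (cstr y) z w.
Proof.
by rewrite /kform cstr_sqr curvN3 curvJ curvJJ addrC.
Qed.

Lemma kformJJ x y z w : kform (cstr x) y (cstr z) w = kform x y z w.
Proof.
by rewrite /kform !cstr_sqr curvN3 curvNr opprK addrC.
Qed.

Lemma kformJ13 x y z w : kform (cstr x) y z w = - kform x y (cstr z) w.
Proof. by rewrite -[in RHS]kformJJ cstr_sqr kformN3 opprK. Qed.

Lemma kformJ34 x y z w : kform x y (cstr z) w = kform x y z (cstr w).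
Proof. by rewrite kform_pair kformJ12 kform_pair. Qed.

(** The curvature is recovered from Q, so it suffices to determine Q. *)
Lemma curv_kform x y z w : 2 * curv y z x w = kform x y z w - kform w y z x.
Proof.
rewrite /kform (curv_asym2 _ _ w) (curv_asym2 _ _ (cstr w)) (curvJr _ _ x).
by ring.
Qed.

Lemma hop_swap x y : inner (hop x y) y = inner (hop y x) x.
Proof. by rewrite !hopP kformC12 kformC34. Qed.

Lemma hopJ x y : hop x (cstr y) = cstr (hop x y).
Proof.
apply: inner_inj => w.
by rewrite innerJ !hopP -kformJ12 kformJ13 kformJ34.
Qed.

Lemma hop_cstr x : hop (cstr x) = hop x.
Proof.
by apply/lfunP => y; apply: inner_inj => w; rewrite !hopP kformJJ.
Qed.

End KahlerForm.

(** * Extrema on the unit sphere and the two-eigenvalue relation *)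

Section Extrema.
Context {R : realType} {H : ah_model R}.
Implicit Types (x y z w : H).

Definition orthonormal_family n (e : 'I_n -> H) :=
  forall i j, inner (e i) (e j) = (i == j)%:R.

Definition comb n (e : 'I_n -> H) (u : 'rV[R]_n) : H := \sum_i u 0 i *: e i.

Lemma comb_linear n (e : 'I_n -> H) : linear (comb e).
Proof.
move=> k u v; rewrite /comb scaler_sumr -big_split /=; apply: eq_bigr => i _.
by rewrite !mxE scalerDl scalerA.
Qed.

Lemma inner_comb n (e : 'I_n -> H) u w :
  inner (comb e u) w = \sum_i u 0 i * inner (e i) w.
Proof.
rewrite (scalar_form_sum _ (inner_scalarl w)).
by apply: eq_bigr => i _; rewrite innerZl.
Qed.

Lemma inner_combE n (e : 'I_n -> H) u i :
  orthonormal_family e -> inner (comb e u) (e i) = u 0 i.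
Proof.
move=> oe; rewrite inner_comb (bigD1 i) //= oe eqxx mulr1 big1 ?addr0 // => j.
by move=> /negbTE ji; rewrite oe ji mulr0.
Qed.

Lemma inner_comb2 n (e : 'I_n -> H) u v : orthonormal_family e ->
  inner (comb e u) (comb e v) = \sum_i u 0 i * v 0 i.
Proof.
move=> oe; rewrite inner_comb; apply: eq_bigr => i _.
by rewrite inner_sym inner_combE.
Qed.

Lemma orthonormal_leq_dim n (e : 'I_n -> H) : orthonormal_family e ->
  (n <= \dim {: H})%N.
Proof.
move=> oe; pose cl := HB.pack_for {linear 'rV[R]_n -> H} (comb e)
  (GRing.isLinear.Build _ _ _ _ (comb e) (comb_linear e)).
pose G := linfun cl.
have GE u : G u = comb e u by rewrite lfunE.
have kG : lker G = 0%VS.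
  apply/vspaceP => u; rewrite memv0 memv_ker GE; apply/eqP/eqP => [u0|->].
    by apply/rowP => i; rewrite -(inner_combE u i oe) u0 inner0l mxE.
  by rewrite -GE linear0.
have := @limg_dim_eq _ _ _ G fullv; rewrite kG capv0 => /(_ erefl) E.
have: (\dim (limg G) <= \dim {: H})%N by rewrite dimvS ?subvf.
by rewrite E dimvf /dim /= mul1n.
Qed.

Lemma orthonormal_extend n (e : 'I_n -> H) v : orthonormal_family e -> unitv v ->
  (forall i, inner (e i) v = 0) ->
  orthonormal_family (fun i : 'I_n.+1 => oapp e v (unlift ord0 i)).
Proof.
move=> oe uv ev i j.
case: (unliftP ord0 i) => [i'|] ->; case: (unliftP ord0 j) => [j'|] ->;
  rewrite /= ?liftK ?unlift_none /= ?(inj_eq lift_inj) //.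
by rewrite inner_sym ev.
Qed.

(** An orthonormal family in U that does not span U can be enlarged by a normalized remainder; were
    there no basis, families longer than the dimension would exist. *)
Lemma orthonormal_basis (U : {vspace H}) : exists n (e : 'I_n -> H),
  [/\ orthonormal_family e, forall i, e i \in U &
      forall x, x \in U -> x = \sum_i inner x (e i) *: e i].
Proof.
apply: contrapT => noB.
suff [e [/orthonormal_leq_dim]] : exists e : 'I_(\dim {: H}).+1 -> H,
    orthonormal_family e /\ forall i, e i \in U by rewrite ltnn.
elim: _.+1 => [|n [e [oe eU]]]; first by exists (fun=> 0); split=> -[].
have [x [xU xe]] : exists x, x \in U /\ x <> \sum_i inner x (e i) *: e i.
  apply: contrapT => nx; apply: noB; exists n, e; split=> // x xU.
  by apply: contrapT => xe; apply: nx; exists x.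
pose y := x - \sum_i inner x (e i) *: e i.
have y0 : y != 0 by rewrite subr_eq0; apply/eqP.
have yU : y \in U.
  by rewrite rpredB // rpred_sum // => i _; rewrite rpredZ.
have ye i : inner (e i) y = 0.
  rewrite innerDr innerNr (scalar_form_sum _ (inner_scalarr _)) (bigD1 i) //=.
  rewrite innerZr oe eqxx big1 => [|j /negbTE ji]; first by
    rewrite inner_sym mulr1 addr0 subrr.
  by rewrite innerZr oe eq_sym ji mulr0.
have [r [v [r0 uv yE _]]] := normalize y0.
exists (fun i : 'I_n.+1 => oapp e v (unlift ord0 i)); split.
  apply: orthonormal_extend => // i; have := ye i.
  by rewrite yE innerZr => /eqP; rewrite mulf_eq0 gt_eqF //= => /eqP.
have vU : v \in U.
  have -> : v = r^-1 *: y by rewrite yE scalerA mulVf ?gt_eqF ?scale1r.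
  by rewrite rpredZ.
by move=> i; case: (unlift ord0 i).
Qed.

Lemma scalar_comb n (e : 'I_n -> H) (phi : H -> R) u : scalar phi ->
  phi (comb e u) = \sum_i u 0 i * phi (e i).
Proof.
move=> lphi; rewrite (scalar_form_sum _ lphi).
by apply: eq_bigr => i _; rewrite (scalar_formZ _ _ lphi).
Qed.

(** This frees one slot of a multilinear expression at a time: a diagonal u -> L(u, u) is continuous
    once each L(u, y) with y fixed is. *)
Lemma continuous_comb n (e : 'I_n -> H) (L : 'rV[R]_n -> H -> R) :
  (forall u, scalar (L u)) -> (forall y, continuous (L^~ y)) ->
  continuous (fun u => L u (comb e u) : R).
Proof.
move=> lL cL.
rewrite (_ : (fun u => _) =
  fun u : 'rV[R]_n => \sum_i u 0 i * L u (e i)); last first.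
  by apply/funext => u; rewrite scalar_comb.
pose g s (u : 'rV[R]_n) : R := \sum_(i <- s) u 0 i * L u (e i).
suff: forall s, continuous (g s) by apply.
elim=> [|i s IH].
  have -> : g [::] = fun=> 0 by apply/funext => v; rewrite /g big_nil.
  exact: cst_continuous.
have -> : g (i :: s) = fun v => v 0 i * L v (e i) + g s v.
  by apply/funext => v; rewrite /g big_cons.
move=> u.
apply: (continuousD _ (IH u)).
exact: (continuousM (@coord_continuous _ _ _ 0 i u) (cL _ u)).
Qed.

(** The diagonal of F attains its maximum on the unit sphere, which is compact in orthonormal
    coordinates; homogeneity of degree 4 extends the bound to every y. *)
Lemma sphere_max (F : H -> H -> H -> H -> R) : {: H}%VS != 0%VS ->
  (forall y z w, scalar (fun x => F x y z w)) ->
  (forall x z w, scalar (fun y => F x y z w)) ->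
  (forall x y w, scalar (fun z => F x y z w)) ->
  (forall x y z, scalar (fun w => F x y z w)) ->
  exists2 e : H, unitv e & forall y, F y y y y <= F e e e e * inner y y ^+ 2.
Proof.
move=> nz s1 s2 s3 s4.
have [n [e [oe _ eB]]] := orthonormal_basis fullv.
pose f (u : 'rV[R]_n) := F (comb e u) (comb e u) (comb e u) (comb e u).
pose S := [set u : 'rV[R]_n | inner (comb e u) (comb e u) = 1]%classic.
have combB x : x = comb e (\row_i inner x (e i)).
  by rewrite {1}(eB x (memvf x)); apply: eq_bigr => i _; rewrite mxE.
have cf : continuous f.
  apply: (continuous_comb (L := fun u => F (comb e u) (comb e u) (comb e u))).
    by move=> u; apply: s4.
  move=> y.
  apply: (continuous_comb (L := fun u z => F (comb e u) (comb e u) z y)).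
    by move=> u; apply: s3.
  move=> z; apply: (continuous_comb (L := fun u w => F (comb e u) w z y)).
    by move=> u; apply: s2.
  move=> w; apply: (continuous_comb (L := fun u x => F x w z y)).
    by move=> u; apply: s1.
  by move=> x; apply: cst_continuous.
have ci : continuous (fun u : 'rV[R]_n => inner (comb e u) (comb e u) : R).
  apply: (continuous_comb (L := fun u => inner (comb e u))).
    by move=> u; apply: inner_scalarr.
  move=> y; apply: (continuous_comb (L := fun u x => inner x y)).
    by move=> u; apply: inner_scalarl.
  by move=> x; apply: cst_continuous.
have cS : compact S.
  apply: bounded_closed_compact.
    exists 1; split => // M M1 u Su; rewrite /= [leLHS]/Num.norm /= mx_normrE.
    apply/bigmax_leP; split; first by rewrite ltW // (lt_trans ltr01).
    move=> [i j] _ /=; rewrite ord1 {i}.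
    apply: (le_trans _ (ltW M1)).
    move: Su; rewrite /S /= inner_comb2 // (bigD1 j) //= => E.
    rewrite -(@expr_le1 _ 2) // real_normK ?num_real // -E expr2 lerDl.
    by rewrite sumr_ge0 // => k _; rewrite -expr2 sqr_ge0.
  have -> : S = ((fun u : 'rV[R]_n => inner (comb e u) (comb e u) : R) @^-1`
      [set x | x = 1])%classic by [].
  by apply: preimage_closed => [u _|]; [exact: ci | exact: closed_eq].
have S0 : (S !=set0)%classic.
  have vp : vpick {: H}%VS != 0 by rewrite vpick0.
  have [r [v [_ uv _ _]]] := normalize vp.
  by exists (\row_i inner v (e i)); rewrite /S /= -combB.
have [c cS1 cmax] := compact_EVT_max S0 cS (continuous_subspaceT cf).
exists (comb e c) => [|y]; first by move: cS1; rewrite inE.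
have [->|/normalize[r [v [r0 uv yE <-]]]] := eqVneq y 0.
  by rewrite (scalar_form0 (s1 _ _ _)) inner0l expr0n /= mulr0.
have := cmax (\row_i inner v (e i)).
rewrite inE /S /= /f -combB yE => /(_ uv) vmax.
rewrite (scalar_formZ _ _ (s1 _ _ _)) (scalar_formZ _ _ (s2 _ _ _)).
rewrite (scalar_formZ _ _ (s3 _ _ _)) (scalar_formZ _ _ (s4 _ _ _)).
rewrite [leRHS]mulrC -exprM; apply: le_trans (_ : r ^+ 4 * F v v v v <= _).
  by rewrite !mulrA !exprS expr0 mulr1 !mulrA.
by rewrite ler_wpM2l // exprn_ge0 // ltW.
Qed.

(** These are the first and second order conditions at the maximum t = 0, obtained from explicit
    small values of t. *)
Lemma quartic_le0 (al be ga de : R) :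
  (forall t, al * t + be * t ^+ 2 + ga * t ^+ 3 + de * t ^+ 4 <= 0) ->
  al = 0 /\ be <= 0.
Proof.
move=> h; pose C := `|be| + `|ga| + `|de|.
have C0 : 0 <= C by rewrite !addr_ge0.
have al0 : al = 0.
  apply: contrapT => /eqP an0.
  (* With t = al / K one has |t| <= 1, and the linear term K t^2 exceeds the rest, which is at most
     C t^2. *)
  pose K := `|al| + C + 1; pose t := al / K.
  have K0 : 0 < K by rewrite /K; have := normr_ge0 al; lra.
  have alE : al = K * t by rewrite /t mulrC divfK ?gt_eqF.
  have t1 : `|t| <= 1.
    rewrite normf_div (gtr0_norm K0) ler_pdivrMr // mul1r /K; lra.
  have t20 : 0 < t ^+ 2.
    rewrite exprn_even_gt0 //=; apply: contraNneq an0 => t0.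
    by rewrite alE t0 mulr0.
  have := h t; rewrite {1}alE.
  have -> : K * t * t + be * t ^+ 2 + ga * t ^+ 3 + de * t ^+ 4 =
    t ^+ 2 * (K + (be + ga * t + de * t ^+ 2)) by ring.
  rewrite pmulr_rle0 // => le0.
  have : `|be + ga * t + de * t ^+ 2| <= C.
    rewrite (le_trans (ler_normD _ _)) // lerD //.
      rewrite (le_trans (ler_normD _ _)) // lerD2l normrM.
      by rewrite ler_piMr.
    by rewrite normrM normrX ler_piMr // exprn_ile1.
  rewrite ler_norml => /andP[h1 _].
  by have := normr_ge0 al; rewrite /K in le0; lra.
split=> //; rewrite leNgt; apply/negP => b0.
pose D := `|ga| + `|de|; have D0 : 0 <= D by rewrite addr_ge0.
(* This t lies in (0, 1] and makes be - t D = t (be + 1) positive. *)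
pose t := be / (be + D + 1).
have den : 0 < be + D + 1 by lra.
have t0 : 0 < t by rewrite divr_gt0.
have t1 : t <= 1 by rewrite ler_pdivrMr //; lra.
have tE : t * (be + D + 1) = be by rewrite divfK ?gt_eqF.
have := h t; rewrite al0 mul0r add0r.
have -> : be * t ^+ 2 + ga * t ^+ 3 + de * t ^+ 4 =
  t ^+ 2 * (be + t * (ga + de * t)) by ring.
rewrite pmulr_rle0 ?exprn_gt0 // => le0.
have : `|ga + de * t| <= D.
  rewrite (le_trans (ler_normD _ _)) // lerD2l normrM (gtr0_norm t0).
  by rewrite ler_piMr.
rewrite ler_norml => /andP[h1 _].
nra.
Qed.

(** The Rayleigh quotient has a maximum at some unit vector e, where its first variation vanishes.
    The factor <z, w> makes the quadratic form quartic, as [sphere_max] requires. *)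
Lemma symmetric_top_eigenvector (S : 'End(H)) : {: H}%VS != 0%VS ->
  (forall x y, inner (S x) y = inner x (S y)) ->
  exists e la, [/\ unitv e, S e = la *: e &
    forall y, inner (S y) y <= la * inner y y].
Proof.
move=> nz symS; pose F x y z w := inner (S x) y * inner z w.
have [e ue emax] : exists2 e : H, unitv e &
    forall y, F y y y y <= F e e e e * inner y y ^+ 2.
  by apply: sphere_max => // *; move=> k u v;
     rewrite /F ?linearD ?linearZ /= !innerE; ring.
pose la := inner (S e) e.
have ray y : inner (S y) y <= la * inner y y.
  have [->|y0] := eqVneq y 0; first by rewrite !innerE mulr0.
  have := emax y; rewrite /F ue mulr1 -/la expr2 mulrA.
  by rewrite ler_pM2r // inner_posdef.
exists e, la; split => //; apply: inner_inj => w.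
have [] := quartic_le0 (al := 2 * (inner (S e) w - la * inner e w))
  (be := inner (S w) w - la * inner w w) (ga := 0) (de := 0).
  move=> t; have := ray (e + t *: w).
  rewrite linearD linearZ /= !innerE (inner_sym w e) (symS w e).
  rewrite (inner_sym w (S e)) ue -/la; lra.
by rewrite innerZl => h _; lra.
Qed.

(** The symmetric operator S = (T - a)(T - b) has only the eigenvalue 0, so the maximum and the
    minimum of its quadratic form vanish and S = 0. *)
Lemma two_eigenvalue_relation (T : 'End(H)) (a b : R) :
  (forall x y, inner (T x) y = inner x (T y)) ->
  (forall la v, v != 0 -> T v = la *: v -> la = a \/ la = b) ->
  forall v, T (T v) = (a + b) *: T v - (a * b) *: v.
Proof.
move=> symT eigT.
have [h0|nz] := eqVneq {: H}%VS 0%VS.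
  move=> v; have /eqP -> : v == 0 by rewrite -memv0 -h0 memvf.
  by rewrite !linear0 addr0.
pose S := (T \o T)%VF - (a + b) *: T + (a * b) *: \1%VF.
have SE v : S v = T (T v) - (a + b) *: T v + (a * b) *: v.
  by rewrite /S !add_lfunE opp_lfunE !scale_lfunE comp_lfunE id_lfunE.
have symS x y : inner (S x) y = inner x (S y).
  by rewrite !SE !innerE !symT.
(* On an eigenvector of S the operator T satisfies a real quadratic equation,
   whose roots are eigenvalues of T. *)
have eig0 e la : unitv e -> S e = la *: e -> la = 0.
  move=> ue Se; pose h := (a + b) / 2; pose D := (a - b) ^+ 2 / 4 + la.
  pose U x := T x - h *: x.
  have UD x y : U (x + y) = U x + U y.
    by rewrite /U linearD scalerDr opprD addrACA.
  have UZ k x : U (k *: x) = k *: U x.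
    by rewrite /U linearZ /= scalerBr !scalerA mulrC.
  have TU x y : T (x - h *: y) = T x - h *: T y by rewrite linearB linearZ.
  have UU : U (U e) = D *: e.
    apply: inner_inj => w; move: (congr1 (inner^~ w) Se).
    rewrite SE /U TU /D !innerE => E.
    have {}E : inner (T (T e)) w = la * inner e w + (a + b) * inner (T e) w
      - a * b * inner e w by lra.
    by rewrite E /h; field.
  have eigU r v : v != 0 -> U v = r *: v -> r ^+ 2 = D -> la = 0.
    move=> v0 Uv rD.
    have Tv : T v = (h + r) *: v by rewrite scalerDl -Uv addrC subrK.
    suff : r ^+ 2 = (a - b) ^+ 2 / 4 by rewrite rD /D; lra.
    by case: (eigT _ _ v0 Tv) => E; (have -> : r = (h + r) - h by ring);
      rewrite E /h; field.
  (* D is the squared norm of U e, so its square root r is real. *)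
  have D0 : 0 <= D.
    have -> : D = inner (U e) (U e).
      have -> : inner (U e) (U e) = inner (U (U e)) e.
        by rewrite /U TU !innerE !symT; ring.
      by rewrite UU innerZl ue mulr1.
    exact: inner_ge0.
  pose r := Num.sqrt D; have rD : r ^+ 2 = D by rewrite sqr_sqrtr.
  (* Since (U - r)(U + r) e = 0, either e is an eigenvector of U for -r or U e + r e is one for
     r. *)
  have [w0|w0] := eqVneq (U e + r *: e) 0.
    apply: (eigU (- r) e) => //; [exact: unit_neq0| |by rewrite sqrrN].
    by rewrite scaleNr; apply/eqP; rewrite -addr_eq0 w0.
  apply: (eigU r (U e + r *: e)) => //.
  by rewrite UD UZ UU -rD [in RHS]scalerDr scalerA -expr2 addrC.
have [e [la [ue Se emax]]] := symmetric_top_eigenvector nz symS.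
have symN x y : inner ((- S) x) y = inner x ((- S) y).
  by rewrite !opp_lfunE !innerE symS.
have [e' [la' [ue' Se' emax']]] := symmetric_top_eigenvector nz symN.
have la0 := eig0 _ _ ue Se.
have la'0 : - la' = 0.
  by apply: (eig0 e') => //; rewrite -[S e']opprK -opp_lfunE Se' scaleNr.
have q0 y : inner (S y) y = 0.
  have := emax y; have := emax' y; rewrite opp_lfunE innerNl; nra.
move=> v; apply/eqP; rewrite -subr_eq0 opprB addrA -[_ - _]addrA (addrC (_ *: v)).
rewrite addrA -SE; apply/eqP/inner_eq0.
(* As the form vanishes at v and at S v, its value at v + S v is twice the squared norm of S v. *)
have := q0 (v + S v); rewrite linearD !innerE !q0 -(symS (S v) v).
rewrite (symS (S v) v); lra.
Qed.

End Extrema.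

(** * Rank one eigenspaces *)

Section Core.
Context {R : realType} {H : ah_model R} (hK : kahler H).
Implicit Types (a b : R) (e u v w x y : H).

Definition quadratic_relation a b := forall x y : H, unitv x ->
  hop x (hop x y) = (a + b) *: hop x y - (a * b) *: y.

(** Complex multiplicity at most 1 for [b], phrased without dimensions. *)
Definition complex_rank_one b := forall x v w : H, unitv x -> v != 0 ->
  hop x v = b *: v -> hop x w = b *: w -> cspan v w.

(* The complex antilinear operator representing Q(ee, -). *)
Definition antiop e u : H := riesz (kform e e u).

Lemma antiopP e u w : inner (antiop e u) w = kform e e u w.
Proof.
by apply: rieszP => k x y; rewrite kformD4 kformZ4.
Qed.

Lemma antiop_sym e u w : inner (antiop e u) w = inner u (antiop e w).
Proof. by rewrite [RHS]inner_sym !antiopP (kformC34 hK). Qed.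

Lemma antiopD e u v : antiop e (u + v) = antiop e u + antiop e v.
Proof.
by apply: inner_inj => w; rewrite innerDl !antiopP kformD3.
Qed.

Lemma antiopZ e k u : antiop e (k *: u) = k *: antiop e u.
Proof. by apply: inner_inj => w; rewrite innerZl !antiopP kformZ3. Qed.

Lemma antiopJ e u : antiop e (cstr u) = - cstr (antiop e u).
Proof.
apply: inner_inj => w.
by rewrite innerNl innerJ opprK !antiopP (kformJ34 hK).
Qed.

Lemma antiop_self e : antiop e e = hop e e.
Proof. by apply: inner_inj => w; rewrite antiopP hopP. Qed.

Lemma hop0 y : hop (0 : H) y = 0.
Proof.
apply: inner_inj => w.
by rewrite hopP inner0l (scalar_form0 (kform_scalar1 _ _ _)).
Qed.

Lemma quadratic_relation_sym a b :
  quadratic_relation a b -> quadratic_relation b a.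
Proof. by move=> h x y ux; rewrite h // (addrC a) (mulrC a). Qed.

Lemma quadratic_relation_scaled a b x y : quadratic_relation a b ->
  hop x (hop x y) = ((a + b) * inner x x) *: hop x y
                    - (a * b * inner x x ^+ 2) *: y.
Proof.
move=> qab; have [->|/normalize[r [v [_ uv -> <-]]]] := eqVneq x 0.
  by rewrite !hop0 inner0l expr2 !mulr0 !scale0r subr0.
rewrite !hopZ linearZ /= qab // scalerBr scalerBr !scalerA.
by congr (_ *: _ - _ *: _); ring.
Qed.

Lemma rank_one_scaled b x v w : complex_rank_one b -> x != 0 -> v != 0 ->
  hop x v = (b * inner x x) *: v -> hop x w = (b * inner x x) *: w ->
  cspan v w.
Proof.
move=> rb /normalize[r [z [r0 uz -> <-]]] v0; rewrite !hopZ => hv hw.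
have r20 : r ^+ 2 != 0 by rewrite expf_neq0 // gt_eqF.
apply: (rb z) => //.
  by apply: (scalerI r20); rewrite hv scalerA mulrC.
by apply: (scalerI r20); rewrite hw scalerA mulrC.
Qed.

(** The cross term of the quadratic map x -> H_x. *)
Definition hop_polar x u y : H := hop (x + u) y - hop x y - hop u y.

Lemma hop_pencil x u y (s : R) : s ^+ 2 = 1 ->
  hop (x + s *: u) y = hop x y + hop u y + s *: hop_polar x u y.
Proof.
move=> s2; apply: inner_inj => w.
rewrite /hop_polar !innerE !hopP !kformE.
ring: s2.
Qed.

Definition principal b e := unitv e /\ hop e e = b *: e.

(** * The operators H_e and H_u around a principal vector e *)

Section Principal.
Context (a b : R) (qab : quadratic_relation a b) (rb : complex_rank_one b).
Context (e : H) (pe : principal b e).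

Let ue : inner e e = 1. Proof. by case: pe. Qed.
Let he : hop e e = b *: e. Proof. by case: pe. Qed.

(** By the quadratic relation H_e u - a u is a b-eigenvector or 0, hence lies in the line of e; by
    symmetry of H_e it is also orthogonal to that line. *)
Lemma hop_principal_orth u : corth e u -> hop e u = a *: u.
Proof.
move=> [eu Jeu]; pose v := hop e u - a *: u.
have hv : hop e v = b *: v.
  rewrite /v linearB linearZ /= qab //; apply: inner_inj => w.
  by rewrite !innerE; ring.
have e0 : e != 0 := unit_neq0 ue.
have hJ : hop e (cstr e) = b *: cstr e by rewrite (hopJ hK) he cstrZ.
have ve : inner v e = 0.
  by rewrite /v !innerE hopC he !innerE (inner_sym u e) eu; ring.
have vJe : inner v (cstr e) = 0.
  by rewrite /v !innerE hopC hJ !innerE (inner_sym u) Jeu; ring.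
have [al [be vE]] := rb ue e0 he hv.
apply/eqP; rewrite -subr_eq0 -/v; apply/eqP/inner_eq0.
by clearbody v; rewrite {2}vE !innerE ve vJe; ring.
Qed.

(** The vector v = H_u e - a |u|^2 e is orthogonal to e, because <H_u e, e> = <H_e u, u>, and
    satisfies H_u v = b |u|^2 v. Hence <v, v> = <v, H_u e> = b |u|^2 <v, e> = 0. *)
Lemma hop_orth_principal u : corth e u -> hop u e = (a * inner u u) *: e.
Proof.
move=> oeu; pose c := a * inner u u; pose v := hop u e - c *: e.
have ve : inner v e = 0.
  rewrite /v innerDl innerNl innerZl (hop_swap hK) hop_principal_orth //.
  by rewrite innerZl ue /c; ring.
apply/eqP; rewrite -subr_eq0 -/v; apply/eqP/inner_eq0.
have hv : hop u v = (b * inner u u) *: v.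
  rewrite /v linearB linearZ /= (quadratic_relation_scaled _ _ qab) /c.
  by apply: inner_inj => w; rewrite !innerE; ring.
have vh : inner v (hop u e) = 0 by rewrite -(hopC u v e) hv innerZl ve mulr0.
by rewrite {2}/v innerDr innerNr innerZr ve vh mulr0 subr0.
Qed.

Lemma antiop_orth u : corth e u -> corth e (antiop e u).
Proof.
move=> oeu; have [h1 h2] := corthJ oeu; case: (oeu) => h3 h4.
split; rewrite -antiop_sym ?antiopJ antiop_self he ?innerNl ?cstrZ innerZl.
  by rewrite h3 mulr0.
by rewrite h4 mulr0 oppr0.
Qed.

(** The quadratic relations of H at e + u and at e - u, both applied to e, are added and subtracted.
    This yields H_u f and T f for f = T e, and then |f|^2 = <e, T f>. *)
Lemma pencil_image u : corth e u ->
  hop u (a *: u + antiop e u) = (b * inner u u) *: (a *: u + antiop e u) /\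
  inner (a *: u + antiop e u) (a *: u + antiop e u) =
    (b - a) ^+ 2 * inner u u.
Proof.
move=> oeu; set f := _ + _; pose T := hop_polar e u.
(* The cross terms are Q(ee, uw), which gives M u, and Q(ue, ew), which gives H_e u = a u. *)
have Te : T e = f.
  apply: inner_inj => w.
  rewrite /T /hop_polar /f !innerE antiopP -innerZl.
  rewrite -hop_principal_orth // !hopP !kformE.
  by rewrite (kformC12 hK u e e); ring.
have symT x y : inner (T x) y = inner x (T y).
  by rewrite /T /hop_polar !innerE !hopC.
have of_ : corth e f.
  by apply: corthD; [exact: corthZ | exact: antiop_orth].
have hf := hop_principal_orth of_.
have hue := hop_orth_principal oeu.
have nrm s : s ^+ 2 = 1 -> inner (e + s *: u) (e + s *: u) = 1 + inner u u.
  case: oeu => eu _ s2.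
  by rewrite !innerE ue (inner_sym u e) eu; ring: s2.
clearbody f.
(* This is the quadratic relation for e + s u at e, multiplied by s. *)
have rel s w : s ^+ 2 = 1 ->
    inner (hop u f) w + s * inner (T f) w =
    s * (b - a) ^+ 2 * inner u u * inner e w + b * inner u u * inner f w.
  move=> s2; have := quadratic_relation_scaled (e + s *: u) e qab.
  rewrite nrm // (hop_pencil e u e s2) -/T he hue Te.
  have hsE : b *: e + (a * inner u u) *: e + s *: f =
      (b + a * inner u u) *: e + s *: f by rewrite scalerDl.
  rewrite hsE linearD !linearZ /= !(hop_pencil e u _ s2) -/T he hue Te hf.
  move: (T f) (hop u f) => tf huf /(congr1 (inner^~ w)); rewrite !innerE => E.
  have sE : forall p q : R, s * p = s * q -> p = q.
    by move=> p q pq; rewrite -[p]mul1r -[q]mul1r -s2 expr2 -!mulrA pq.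
  by apply: sE; move/eqP: E; rewrite -subr_eq0 => /eqP E; apply/eqP;
     rewrite -subr_eq0 -E; apply/eqP; ring: s2.
have sN : (-1) ^+ 2 = 1 :> R by rewrite sqrrN expr1n.
have hfE : hop u f = (b * inner u u) *: f.
  apply: inner_inj => w; rewrite innerZl.
  by have := rel 1 w (expr1n _ _); have := rel (-1) w sN; lra.
have TfE : T f = ((b - a) ^+ 2 * inner u u) *: e.
  apply: inner_inj => w; rewrite innerZl.
  by have := rel 1 w (expr1n _ _); rewrite hfE innerZl; lra.
by split=> //; rewrite -{1}Te symT TfE innerZr ue mulr1.
Qed.

(** Since M is antilinear, passing from u to Ju turns a u + M u into J (a u - M u), while H_u is
    unchanged and commutes with J. Sum and difference separate the two terms. *)
Lemma antiop_eigenvector u : corth e u ->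
  [/\ hop u (a *: u) = (b * inner u u) *: (a *: u),
      hop u (antiop e u) = (b * inner u u) *: antiop e u,
      a * inner u (antiop e u) = 0 &
      inner (antiop e u) (antiop e u) = ((b - a) ^+ 2 - a ^+ 2) * inner u u].
Proof.
move=> oeu; have [h1 n1] := pencil_image oeu.
have [h2 n2] := pencil_image (corthJ oeu).
have JE : a *: cstr u + antiop e (cstr u) = cstr (a *: u - antiop e u).
  by rewrite antiopJ cstrD cstrN cstrZ.
move: h2 n2; rewrite JE hop_cstr (hopJ hK) !cstr_isom -cstrZ.
move=> /cstr_inj h2 n2; move: h1 n1 h2 n2.
rewrite linearD linearB; move: (antiop e u) => m h1 n1 h2 n2.
have h1w w := congr1 (inner^~ w) h1; have h2w w := congr1 (inner^~ w) h2.
split.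
- by apply: inner_inj => w; move: (h1w w) (h2w w); rewrite !innerE; lra.
- by apply: inner_inj => w; move: (h1w w) (h2w w); rewrite !innerE; lra.
- by move: n1 n2; rewrite !innerE (inner_sym m u); lra.
by move: n1 n2; rewrite !innerE (inner_sym m u); lra.
Qed.

(** Both u and M u lie in one complex line of eigenvectors of H_u, yet M u is orthogonal to u and
    Ju; so M u = 0, and its norm formula gives (b - a)^2 = a^2. *)
Lemma antiop_eq0 u : a != 0 -> u != 0 -> corth e u ->
  [/\ hop u u = (b * inner u u) *: u, antiop e u = 0 & b * (b - 2 * a) = 0].
Proof.
move=> a0 u0 oeu; have [hu hm um mm] := antiop_eigenvector oeu.
have {}hu : hop u u = (b * inner u u) *: u.
  by apply: (scalerI a0); rewrite scalerA mulrC -scalerA -hu linearZ.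
have {}um : inner u (antiop e u) = 0.
  by apply/eqP; move/eqP: um; rewrite mulf_eq0 (negbTE a0).
(* The orthogonality of a vector and its image under M, applied to u + Ju, leaves 2a <Ju, M u> =
   0. *)
have Jum : inner (cstr u) (antiop e u) = 0.
  have [_ _ + _] := antiop_eigenvector (corthD oeu (corthJ oeu)).
  rewrite antiopD antiopJ !innerE cstr_isom -innerJ => /eqP.
  rewrite mulf_eq0 (negbTE a0) /= => /eqP.
  rewrite innerJ -(innerJ u); lra.
have [al [be mE]] := rank_one_scaled rb u0 u0 hu hm.
have m0 : antiop e u = 0.
  by apply: inner_eq0; rewrite {1}mE !innerE um Jum; ring.
split=> //; move: mm; rewrite m0 inner0l => /esym/eqP.
by rewrite mulf_eq0 (negbTE (inner_neq0 u0)) orbF => /eqP; lra.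
Qed.

(** H_e depends only on the complex line of e, so every unit vector of that line is principal
    too. *)
Lemma principal_rotate p : cspan e p -> p != 0 -> exists e' r,
  [/\ principal b e', p = r *: e' & forall u, corth e u -> corth e' u].
Proof.
move=> [al [be pE]] /normalize[r [e' [r0 ue' pr _]]].
have e'E : e' = (r^-1 * al) *: e + (r^-1 * be) *: cstr e.
  by rewrite -!scalerA -scalerDr -pE pr scalerA mulVf ?scale1r ?gt_eqF.
exists e', r; split=> //; last first.
  move=> u [h1 h2]; split; rewrite e'E ?cstrD ?cstrZ ?cstr_sqr !innerE.
    by rewrite h1 h2; ring.
  by rewrite h1 h2; ring.
split=> //; move: ue'; move: (r^-1 * al) (r^-1 * be) e'E => s t -> ue'.
have st1 : s ^+ 2 + t ^+ 2 = 1.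
  have eJ : inner (cstr e) e = 0 by rewrite inner_sym inner_cstr.
  by move: ue'; rewrite /unitv !innerE cstr_isom inner_cstr eJ ue => <-; ring.
rewrite {1}/hop jacobi_rot // -/(hop e) linearD !linearZ /= (hopJ hK) he cstrZ.
by rewrite scalerDr !scalerA !(mulrC b).
Qed.

End Principal.

(* D(x, -, x, -) determines D(x, -, z, -) up to its part antisymmetric in x, z;
   complex linearity in one slot and antilinearity in the other kill that part. *)
Lemma polarization_eq0 (D : H -> H -> H -> H -> R) (P : H -> Prop) :
  (forall x, P x -> P (cstr x)) -> (forall x y, P x -> P y -> P (x + y)) ->
  (forall x x' y z w, D (x + x') y z w = D x y z w + D x' y z w) ->
  (forall x x' y z w, D y z (x + x') w = D y z x w + D y z x' w) ->
  (forall x y z w, D (cstr x) y z w = D x (cstr y) z w) ->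
  (forall x y z w, D (cstr x) y z w = - D x y (cstr z) w) ->
  (forall x y w, P x -> D x y x w = 0) ->
  forall x y z w, P x -> P z -> D x y z w = 0.
Proof.
move=> PJ PD D1 D3 J12 J13 D0 x y z w Px Pz.
have swap x' y' z' : P x' -> P z' -> D x' y' z' w = - D z' y' x' w.
  move=> Px' Pz'; have := D0 (x' + z') y' w (PD _ _ Px' Pz').
  by rewrite D1 !D3 !D0 //; lra.
have DJ x' y' z' : P x' -> P z' -> D (cstr x') y' z' w = 0.
  move=> Px' Pz'.
  have h1 : D (cstr x') y' z' w = D (cstr z') y' x' w.
    by rewrite (swap _ _ _ (PJ _ Px') Pz') J13.
  have h2 : D (cstr z') y' x' w = - D (cstr x') y' z' w.
    by rewrite J12 (swap z') // -J12.
  by move: h1; rewrite h2; lra.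
(* As J^4 = 1, every x is the image under J of a vector satisfying P. *)
have -> : x = cstr (cstr (cstr (cstr x))) by rewrite !cstr_sqr opprK.
exact: DJ (PJ _ (PJ _ (PJ _ Px))) Pz.
Qed.

(** For x = r e' + u with e' principal and u orthogonal to its line, Q(xx, xx) = b r^4 + 4 a r^2
    |u|^2 + b |u|^4, which is b |x|^4 when b = 2a. *)
Lemma constant_hol_sec_of_principal a b e :
  quadratic_relation a b -> complex_rank_one b -> principal b e ->
  a != 0 -> b = 2 * a -> const_hol_sec H.
Proof.
move=> qab rb pe a0 b2; exists b => x ux; rewrite hol_secE.
have orth u : corth e u -> hop u u = (b * inner u u) *: u.
  move=> ou; have [->|u0] := eqVneq u 0; first by rewrite hop0 scaler0.
  by have [] := antiop_eq0 qab rb pe a0 u0 ou.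
suff -> : kform x x x x = b * inner x x ^+ 2 by rewrite ux expr1n mulr1.
have [p [u [ep ou ->]]] := csplit x pe.1.
have [->|p0] := eqVneq p 0.
  by rewrite add0r -hopP orth // innerZl; ring.
have [e' [r [pe' -> o']]] := principal_rotate pe ep p0.
have {}ou' := o' _ ou; have [eu Jeu] := ou'; have huu := orth _ ou.
have ue' : inner e' e' = 1 by case: pe'.
have he' : hop e' e' = b *: e' by case: pe'.
have k1 : kform e' e' e' u = 0 by rewrite -hopP he' innerZl eu mulr0.
have k3 : kform u u u e' = 0 by rewrite -hopP huu innerZl inner_sym eu mulr0.
have k2 : kform e' e' u u = 0.
  rewrite -antiopP; have [->|u0] := eqVneq u 0; first by rewrite inner0r.
  by have [_ -> _] := antiop_eq0 qab rb pe' a0 u0 ou'; rewrite inner0l.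
have k4 : kform e' u e' u = a * inner u u.
  by rewrite -hopP (hop_principal_orth qab rb pe') // innerZl.
have k5 : kform u u u u = b * inner u u ^+ 2.
  by rewrite -hopP huu innerZl; ring.
have k0 : kform e' e' e' e' = b by rewrite -hopP he' innerZl ue' mulr1.
have C12 := kformC12 hK; have C34 := kformC34 hK.
have e1 : kform e' u e' e' = 0 by rewrite kform_pair.
have e2 : kform e' e' u e' = 0 by rewrite C34.
have e3 : kform u e' e' e' = 0 by rewrite C12.
have e4 : kform u u e' u = 0 by rewrite C34.
have e5 : kform e' u u u = 0 by rewrite kform_pair.
have e6 : kform u e' u u = 0 by rewrite C12.
have e7 : kform u u e' e' = 0 by rewrite kform_pair.
have e8 : kform e' u u e' = a * inner u u by rewrite C34.
have e9 : kform u e' e' u = a * inner u u by rewrite C12.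
have e10 : kform u e' u e' = a * inner u u by rewrite C12.
rewrite !kformE !innerE ue' (inner_sym u e') eu k0 k1 k2 k3 k4 k5.
by rewrite e1 e2 e3 e4 e5 e6 e7 e8 e9 e10 b2; ring.
Qed.

(** * The case a = 0: a real structure, and Q of rank one *)

Section PrincipalFlat.
Context (b : R) (q0b : quadratic_relation 0 b) (rb : complex_rank_one b).
Context (e : H) (pe : principal b e) (b0 : b != 0).

(* Locked, since the scaling inside would otherwise be exposed by rewriting
   with linearity lemmas. *)
Definition conjugation u : H := locked (b^-1 *: antiop e u).
Local Notation tau := conjugation.

Lemma conjugationE u : tau u = b^-1 *: antiop e u.
Proof. by rewrite /conjugation -lock. Qed.

Lemma conjugationD u v : tau (u + v) = tau u + tau v.
Proof. by rewrite !conjugationE antiopD scalerDr. Qed.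
Lemma conjugationZ k u : tau (k *: u) = k *: tau u.
Proof. by rewrite !conjugationE antiopZ !scalerA mulrC. Qed.
Lemma conjugationJ u : tau (cstr u) = - cstr (tau u).
Proof. by rewrite !conjugationE antiopJ scalerN cstrZ. Qed.
Lemma conjugation_sym u v : inner (tau u) v = inner u (tau v).
Proof. by rewrite !conjugationE innerZl innerZr antiop_sym. Qed.

Lemma conjugation_principal : tau e = e.
Proof.
by rewrite conjugationE antiop_self pe.2 scalerA mulVf ?scale1r.
Qed.

Lemma conjugation_orth u : corth e u -> corth e (tau u).
Proof.
by move=> ou; rewrite conjugationE; apply: corthZ; apply: (antiop_orth pe).
Qed.

Lemma conjugation_norm u : corth e u -> inner (tau u) (tau u) = inner u u.
Proof.
move=> /(antiop_eigenvector q0b rb pe)[_ _ _ h].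
by rewrite !conjugationE !innerE h; field.
Qed.

(** On the complement of e, [tau] is symmetric and isometric, so tau (tau v) and v have equal norms
    and inner product |v|^2; hence they coincide. *)
Lemma conjugationK u : tau (tau u) = u.
Proof.
have [p [v [[s [t ->]] ov ->]]] := csplit u pe.1.
have tJe : tau (tau (cstr e)) = cstr e.
  rewrite conjugationJ conjugation_principal -scaleN1r conjugationZ.
  by rewrite conjugationJ conjugation_principal scaleN1r opprK.
have TZ k x : tau (tau (k *: x)) = k *: tau (tau x).
  by rewrite (conjugationZ k x) (conjugationZ k (tau x)).
rewrite !conjugationD !TZ tJe !conjugation_principal; congr (_ + _).
apply: inner_sub_eq0; have otv := conjugation_orth ov.
rewrite (conjugation_norm otv) (conjugation_sym (tau v)) (conjugation_norm ov).
ring.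
Qed.

(** The difference between Re Q and b times the rank one Hermitian form built from the complex
    symmetric bilinear form attached to [tau]. *)
Definition flat_defect x y z w : R := kform x y z w - b *
  (inner (tau x) y * inner (tau z) w +
   inner (cstr (tau x)) y * inner (cstr (tau z)) w).
Local Notation D := flat_defect.

Lemma flat_defectD1 x x' y z w : D (x + x') y z w = D x y z w + D x' y z w.
Proof. by rewrite /D conjugationD cstrD !innerE kformD1; ring. Qed.
Lemma flat_defectD3 x x' y z w : D y z (x + x') w = D y z x w + D y z x' w.
Proof. by rewrite /D conjugationD cstrD !innerE kformD3; ring. Qed.
Lemma flat_defectZ1 k x y z w : D (k *: x) y z w = k * D x y z w.
Proof. by rewrite /D conjugationZ cstrZ !innerE kformZ1; ring. Qed.
Lemma flat_defectJ12 x y z w : D (cstr x) y z w = D x (cstr y) z w.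
Proof.
rewrite /D (kformJ12 hK) conjugationJ cstrN cstr_sqr opprK cstr_isom innerNl.
by rewrite (innerJ (tau x)); ring.
Qed.
Lemma flat_defectJ13 x y z w : D (cstr x) y z w = - D x y (cstr z) w.
Proof.
rewrite /D kformJ13 !conjugationJ !cstrN !cstr_sqr !opprK !innerNl.
by ring.
Qed.
Lemma flat_defectC12 x y z w : D x y z w = D y x z w.
Proof.
have E1 : inner (tau x) y = inner (tau y) x.
  by rewrite conjugation_sym inner_sym.
have E2 : inner (cstr (tau x)) y = inner (cstr (tau y)) x.
  by rewrite innerJ conjugation_sym conjugationJ innerNr opprK inner_sym.
by rewrite /D (kformC12 hK) E1 E2.
Qed.
Lemma flat_defect_pair x y z w : D x y z w = D z w x y.
Proof. by rewrite /D kform_pair; ring. Qed.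
Lemma flat_defectC34 x y z w : D x y z w = D x y w z.
Proof. by rewrite flat_defect_pair flat_defectC12 flat_defect_pair. Qed.

(** At p = q = e this is the definition of M = b tau; complex linearity covers the rest of the
    line. *)
Lemma flat_defect_principal p q z w : cspan e p -> cspan e q -> D p q z w = 0.
Proof.
have Je : inner (cstr e) e = 0 by rewrite inner_sym inner_cstr.
have ue : inner e e = 1 := pe.1.
have D0 z' w' : D e e z' w' = 0.
  rewrite /D conjugation_principal Je ue mul0r addr0 mul1r conjugationE.
  rewrite innerZl antiopP.
  by field.
have DJ z' w' : D (cstr e) e z' w' = 0 by rewrite flat_defectJ13 D0 oppr0.
move=> [s [t ->]] [s' [t' ->]].
rewrite flat_defectD1 !flat_defectZ1 !(flat_defectC12 _ (_ + _)).
rewrite !flat_defectD1 !flat_defectZ1 D0 DJ flat_defectC12 DJ.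
by rewrite flat_defectJ12 flat_defectC12 flat_defectJ13 DJ; ring.
Qed.

(** With a = 0 the relation reads H_u H_u = b |u|^2 H_u, so every H_u y lies in the complex line of
    tau u. Pairing with tau u and J tau u gives its coefficients. *)
Lemma flat_defect_orth u y w : corth e u -> D u y u w = 0.
Proof.
move=> ou; have tn := conjugation_norm ou.
have [u0|u0] := eqVneq u 0.
  have z0 : D 0 y u w = 0.
    by have := flat_defectZ1 0 u y u w; rewrite scale0r mul0r.
  by rewrite {1}u0.
have tu0 : tau u != 0.
  by apply: contra_neq u0 => t0; apply: inner_eq0; rewrite -tn t0 inner0l.
have htau : hop u (tau u) = (b * inner u u) *: tau u.
  have [_ h _ _] := antiop_eigenvector q0b rb pe ou.
  by rewrite conjugationE linearZ /= h !scalerA mulrC.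
have hy : hop u (hop u y) = (b * inner u u) *: hop u y.
  by rewrite (quadratic_relation_scaled _ _ q0b) add0r !mul0r scale0r subr0.
have [s [t E]] := rank_one_scaled rb u0 tu0 htau hy.
have uu0 := inner_neq0 u0.
have Jt : inner (cstr (tau u)) (tau u) = 0 by rewrite inner_sym inner_cstr.
have Es : s = b * inner (tau u) y.
  have := hopC u y (tau u); rewrite htau E !innerE Jt tn (inner_sym y).
  rewrite mulr0 addr0 => Es; apply: (mulIf uu0); rewrite Es; ring.
have Et : t = b * inner (cstr (tau u)) y.
  have := hopC u y (cstr (tau u)); rewrite (hopJ hK) htau E cstrZ !innerE.
  rewrite inner_cstr cstr_isom tn (inner_sym y).
  rewrite mulr0 add0r => Et; apply: (mulIf uu0); rewrite Et; ring.
rewrite /D -hopP E !innerE Es Et; ring.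
Qed.

(** Polarization kills the defect when x and z are orthogonal to the line of e. After splitting all
    arguments, the symmetries leave only terms with a whole pair, x, y or z, w, in that line. *)
Lemma kform_flat x y z w : kform x y z w = b *
  (inner (tau x) y * inner (tau z) w +
   inner (cstr (tau x)) y * inner (cstr (tau z)) w).
Proof.
suff : D x y z w = 0 by rewrite /D => /eqP; rewrite subr_eq0 => /eqP.
have orth u v y' w' : corth e u -> corth e v -> D u y' v w' = 0.
  apply: polarization_eq0.
  - by move=> ?; apply: corthJ.
  - by move=> ? ?; apply: corthD.
  - exact: flat_defectD1.
  - exact: flat_defectD3.
  - exact: flat_defectJ12.
  - exact: flat_defectJ13.
  - by move=> ? ? ?; apply: flat_defect_orth.
have half u y' z' w' : corth e u -> D u y' z' w' = 0.
  move=> ou; have [p [v [ep ov ->]]] := csplit z' pe.1.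
  have [q [v' [eq ov' ->]]] := csplit w' pe.1.
  rewrite flat_defectD3 (orth _ v) // addr0 flat_defectC34 flat_defectD3.
  rewrite (orth _ v') // addr0 flat_defect_pair.
  exact: flat_defect_principal.
have [p [u [ep ou ->]]] := csplit x pe.1.
have [q [v [eq ov ->]]] := csplit y pe.1.
rewrite flat_defectD1 (half u) // addr0 flat_defectC12 flat_defectD1 (half v) //.
rewrite addr0.
exact: flat_defect_principal.
Qed.

End PrincipalFlat.

End Core.

(** * Extremal holomorphic sectional curvature *)

Section Osserman.
Context {R : realType} {H : ah_model R} (hK : kahler H).
Implicit Types (e u v w x y : H) (a b la : R).

(* [s] is 1 at a maximum and -1 at a minimum. *)
Lemma extremal_principal (s la : R) e : s != 0 -> unitv e ->
  (forall y, s * kform y y y y <= s * la * inner y y ^+ 2) ->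
  kform e e e e = la ->
  principal la e /\
  forall u, corth e u -> s * (2 * inner (hop e u) u) <= s * la * inner u u.
Proof.
move=> s0 ue emax kla; have C12 := kformC12 hK; have C34 := kformC34 hK.
have var u : inner e u = 0 -> kform e e e u = 0 /\
    s * (2 * kform e e u u + 4 * kform e u e u) <= s * (2 * la * inner u u).
  (* The quartic is s (Q(xx, xx) - la |x|^4) at x = e + t u. *)
  move=> eu; have [] := quartic_le0 (al := s * (4 * kform e e e u))
    (be := s * (2 * kform e e u u + 4 * kform e u e u)
           - s * (2 * la * inner u u))
    (ga := s * (4 * kform u u u e))
    (de := s * (kform u u u u - la * inner u u ^+ 2)).
    move=> t; have := emax (e + t *: u); rewrite -subr_le0.
    rewrite !kformE !innerE ue (inner_sym u e) eu kla.
    have e2 : kform e e u e = kform e e e u by rewrite C34.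
    have e1 : kform e u e e = kform e e e u by rewrite kform_pair.
    have e3 : kform u e e e = kform e e e u by rewrite C12.
    have e4 : kform u u e u = kform u u u e by rewrite C34.
    have e5 : kform e u u u = kform u u u e by rewrite kform_pair.
    have e6 : kform u e u u = kform u u u e by rewrite C12.
    have e7 : kform u u e e = kform e e u u by rewrite kform_pair.
    have e8 : kform e u u e = kform e u e u by rewrite C34.
    have e9 : kform u e e u = kform e u e u by rewrite C12.
    have e10 : kform u e u e = kform e u e u by rewrite C12.
    rewrite e1 e2 e3 e4 e5 e6 e7 e8 e9 e10.
    by apply: le_trans; rewrite le_eqVlt; apply/orP; left; apply/eqP; ring.
  move=> /eqP; rewrite !mulf_eq0 (negbTE s0) pnatr_eq0 /= => /eqP -> h.
  by split=> //; rewrite -subr_le0.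
split; first split => //.
  apply: inner_inj => w; pose u := w - inner e w *: e.
  have eu : inner e u = 0 by rewrite /u !innerE ue; ring.
  have [h _] := var u eu.
  have -> : w = inner e w *: e + u by rewrite /u addrC subrK.
  rewrite innerDr innerZr !hopP h kla.
  by rewrite innerZl innerDr innerZr eu ue; ring.
move=> u ou; have [_ h1] := var u ou.1.
have [_ h2] := var _ (corthJ ou).1.
(* Replacing u by Ju flips the sign of Q(ee, uu) and keeps Q(eu, eu), so adding the two second
   variations eliminates the former. *)
have E1 : kform e e (cstr u) (cstr u) = - kform e e u u.
  by rewrite (kformJ34 hK) cstr_sqr kformN4.
have E2 : kform e (cstr u) e (cstr u) = kform e u e u.
  by rewrite C12 C34 kformJJ C12 C34.
move: h1 h2; rewrite E1 E2 cstr_isom hopP; lra.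
Qed.

Lemma extremal_exists (s : R) : s != 0 -> {: H}%VS != 0%VS ->
  exists e la, [/\ principal la e,
    forall u, corth e u -> s * (2 * inner (hop e u) u) <= s * la * inner u u &
    forall y, s * kform y y y y <= s * la * inner y y ^+ 2].
Proof.
move=> s0 nz.
have [e ue emax] : exists2 e : H, unitv e & forall y,
    s * kform y y y y <= s * kform e e e e * inner y y ^+ 2.
  apply: (sphere_max (F := fun x y z w => s * kform x y z w) nz).
  - by move=> y z w k u v; rewrite !kformE; ring.
  - by move=> y z w k u v; rewrite !kformE; ring.
  - by move=> y z w k u v; rewrite !kformE; ring.
  - by move=> y z w k u v; rewrite !kformE; ring.
exists e, (kform e e e e).
by have [] := extremal_principal s0 ue emax erefl.
Qed.

Definition cline x : {vspace H} := (<[x]> + <[cstr x]>)%VS.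

Lemma mem_cline x y : y \in cline x -> cspan x y.
Proof.
by move=> /memv_addP[_ /vlineP[s ->] [_ /vlineP[t ->] ->]]; exists s, t.
Qed.

Lemma cline_complex x : x != 0 -> complex_line (cline x).
Proof.
move=> x0; split.
  rewrite /cline dimv_disjoint_sum ?dim_vline; last first.
    apply/eqP; rewrite -subv0; apply/subvP => y; rewrite memv_cap memv0.
    move=> /andP[/vlineP[s ys] /vlineP[t yt]].
    by apply/eqP/inner_eq0; rewrite {1}ys yt !innerE inner_cstr !mulr0.
  have -> : cstr x != 0.
    by apply: contra_neq x0 => h; apply: inner_eq0; rewrite -cstr_isom h inner0l.
  by rewrite x0.
apply/subvP => _ /memv_imgP[y /mem_cline[s [t ->]] ->].
rewrite cstrD !cstrZ cstr_sqr scalerN -scaleNr addrC.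
by apply: memv_add; rewrite rpredZ ?memv_line.
Qed.

Lemma cline_self x : x \in cline x.
Proof. exact: (subvP (addvSl _ _) _ (memv_line x)). Qed.

Lemma cline_sub x (U : {vspace H}) : x \in U -> cstr x \in U ->
  (cline x <= U)%VS.
Proof. by rewrite /cline subv_add -!memvE => -> ->. Qed.

Lemma cspan_of_dim_le2 (U : {vspace H}) v w :
  (forall y, y \in U -> cstr y \in U) -> (\dim U <= 2)%N -> v != 0 ->
  v \in U -> w \in U -> cspan v w.
Proof.
move=> UJ dU v0 vU wU; apply: mem_cline; move: wU.
suff /eqP -> : cline v == U by [].
by rewrite eqEdim cline_sub ?UJ // (cline_complex v0).1.
Qed.

Lemma corth_of_dim_gt2 (U : {vspace H}) e :
  (forall y, y \in U -> cstr y \in U) -> (2 < \dim U)%N -> unitv e ->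
  e \in U -> exists u, [/\ u != 0, u \in U & corth e u].
Proof.
move=> UJ dU ue eU.
have /subvPn[w wU wn] : ~~ (U <= cline e)%VS.
  apply: contraL dU => /dimvS; rewrite (cline_complex (unit_neq0 ue)).1.
  by rewrite -leqNgt.
have [p [u [[s [t pE]] ou wE]]] := csplit w ue.
have pU : p \in cline e by rewrite pE memv_add // rpredZ ?memv_line.
exists u; split=> //.
  by apply: contraNneq wn => u0; rewrite wE u0 addr0.
have -> : u = w - p by rewrite wE addrC addKr.
by rewrite rpredB // (subvP (cline_sub eU (UJ _ eU))).
Qed.

Definition hop_eigenspace x la := passmx.leigenspace (hop x) la.

Lemma mem_hop_eigenspace x la v :
  (v \in hop_eigenspace x la) = (hop x v == la *: v).
Proof.
by rewrite memv_ker add_lfunE opp_lfunE scale_lfunE id_lfunE subr_eq0.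
Qed.

Lemma hop_eigenspaceJ x la v :
  v \in hop_eigenspace x la -> cstr v \in hop_eigenspace x la.
Proof.
by rewrite !mem_hop_eigenspace (hopJ hK) => /eqP ->; rewrite cstrZ.
Qed.

Lemma cjacobi_cline x : unitv x -> cjacobi (cline x) = hop x.
Proof.
by move=> ux; rewrite (cjacobiE (cline_complex (unit_neq0 ux)) (cline_self x) ux).
Qed.

(** * Eigenvalues of the model and of each H_x *)

Section Spectrum.
Context (hO : complex_osserman H) (a b : R).
Context (spec : forall c, model_eigenvalue H c <-> c = a \/ c = b).

Lemma dim_hop_eigenspace x y la : unitv x -> unitv y ->
  \dim (hop_eigenspace x la) = \dim (hop_eigenspace y la).
Proof.
move=> ux uy; rewrite /hop_eigenspace -!cjacobi_cline //.
by apply: hO.2; apply: cline_complex; apply: unit_neq0.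
Qed.

Lemma hop_eigenvalue x la v : unitv x -> v != 0 -> hop x v = la *: v ->
  la = a \/ la = b.
Proof.
move=> ux v0 hv; apply/spec; exists (cline x).
  exact/cline_complex/unit_neq0.
rewrite cjacobi_cline // /passmx.leigenvalue.
apply: contraNneq v0 => E0; rewrite -memv0 -E0 -/(hop_eigenspace x la).
by rewrite mem_hop_eigenspace hv.
Qed.

(** The eigenvalue occurs on some complex line; equality of eigenspace dimensions carries it to
    x. *)
Lemma hop_eigenvector x la : unitv x -> la = a \/ la = b ->
  exists2 v, v != 0 & hop x v = la *: v.
Proof.
move=> ux /spec[pi cpi ev].
have pi0 : vpick pi != 0 by rewrite vpick0 -dimv_eq0 cpi.1.
have [r [y [r0 uy pE _]]] := normalize pi0.
have ypi : y \in pi.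
  have -> : y = r^-1 *: vpick pi by rewrite pE scalerA mulVf ?scale1r ?gt_eqF.
  by rewrite rpredZ // memv_pick.
move: ev; rewrite (cjacobiE cpi ypi uy) -/(hop y) /passmx.leigenvalue.
rewrite -/(hop_eigenspace y la) -dimv_eq0 (dim_hop_eigenspace _ uy ux) dimv_eq0.
move=> E0; exists (vpick (hop_eigenspace x la)); first by rewrite vpick0.
by apply/eqP; rewrite -mem_hop_eigenspace memv_pick.
Qed.

Lemma osserman_relation : quadratic_relation (H := H) a b.
Proof.
move=> x y ux; apply: two_eigenvalue_relation => [u v|la v v0 hv].
  exact: hopC.
exact: hop_eigenvalue ux v0 hv.
Qed.

Lemma rank_one_of_dim x la : unitv x ->
  (\dim (hop_eigenspace x la) <= 2)%N -> complex_rank_one (H := H) la.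
Proof.
move=> ux dle y v w uy v0 hv hw.
apply: (@cspan_of_dim_le2 (hop_eigenspace y la)) => //.
- by move=> z; apply: hop_eigenspaceJ.
- by rewrite (dim_hop_eigenspace _ uy ux).
- by rewrite mem_hop_eigenspace hv.
by rewrite mem_hop_eigenspace hw.
Qed.

End Spectrum.

(** If neither eigenvalue vanishes, an a-eigenvector of H_e, being orthogonal to the line of e,
    forces b = 2a and hence constant s. *)
Lemma principal_dichotomy a b e : ~ const_hol_sec H ->
  complex_osserman H ->
  (forall c, model_eigenvalue H c <-> c = a \/ c = b) -> a != b ->
  complex_rank_one (H := H) b -> principal b e -> a = 0 \/ b = 0.
Proof.
move=> hs hO spec ab rb pe.
have qab := osserman_relation spec.
have [|/eqP a0] := pselect (a = 0); first by left.
have [|/eqP b0] := pselect (b = 0); first by right.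
case: hs; apply: (constant_hol_sec_of_principal hK qab rb pe a0).
have [u u0 hu] := hop_eigenvector hO spec pe.1 (or_introl erefl).
have orth z : hop e z = b *: z -> inner z u = 0.
  move=> hz; have := hopC e z u; rewrite hz hu innerZl innerZr => /eqP.
  by rewrite -subr_eq0 -mulrBl mulf_eq0 subr_eq0 eq_sym (negbTE ab) => /eqP.
have ou : corth e u.
  split; apply: orth; first exact: pe.2.
  by rewrite (hopJ hK) pe.2 cstrZ.
have [_ _ /eqP] := antiop_eq0 hK qab rb pe a0 u0 ou.
by rewrite mulf_eq0 (negbTE b0) /= subr_eq0 => /eqP.
Qed.

Lemma flat_principal_exists : ~ const_hol_sec H -> complex_osserman H ->
  two_eigenvalues H -> {: H}%VS != 0%VS -> exists b e,
  [/\ quadratic_relation (H := H) 0 b, complex_rank_one (H := H) b,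
      principal b e & b != 0].
Proof.
move=> hs hO [a0 [b0 [ab0 spec0]]] nz.
have [a [b [ltab spec]]] : exists a b, a < b /\
    forall c, model_eigenvalue H c <-> c = a \/ c = b.
  case: (ltgtP a0 b0) => [lt|lt|//]; first by exists a0, b0.
  by exists b0, a0; split=> // c; rewrite spec0; split=> -[]; tauto.
have spec' c : model_eigenvalue H c <-> c = b \/ c = a.
  by rewrite spec; split=> -[]; tauto.
have ab : a != b by rewrite lt_eqF.
have ba : b != a by rewrite gt_eqF.
have qab := osserman_relation spec.
have [e [la [pe secmax emax]]] := extremal_exists (oner_neq0 R) nz.
have N1 : -1 != 0 :> R by rewrite oppr_eq0 oner_neq0.
have [f [ka [pf secmin fmin]]] := extremal_exists N1 nz.
have eig (x : H) (c : R) : principal c x -> c = a \/ c = b.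
  by case=> ux; apply: hop_eigenvalue => //; exact: unit_neq0.
have kale : ka <= la.
  have := fmin e; rewrite -hopP pe.2 innerZl pe.1; lra.
have kanla : ka <> la.
  move=> E; case: hs; exists la => x ux; rewrite hol_secE.
  have := emax x; have := fmin x; rewrite ux E; lra.
(* Both extremal values are eigenvalues, and they differ because s is not constant. *)
have [laE kaE] : la = b /\ ka = a.
  by case: (eig _ _ pe) (eig _ _ pf) => [->|->] [->|->] in kale kanla *;
     split; lra.
subst la ka.
(* A b-eigenvector u orthogonal to the line of e turns the second variation into 2b |u|^2 <= b
   |u|^2. *)
have big_b : (2 < \dim (hop_eigenspace e b))%N -> b <= 0.
  move=> dim2; have [||u [u0 uE ou]] := corth_of_dim_gt2 _ dim2 pe.1.
  - by move=> y; apply: hop_eigenspaceJ.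
  - by rewrite mem_hop_eigenspace pe.2.
  have := secmax u ou; move: uE; rewrite mem_hop_eigenspace => /eqP ->.
  by rewrite innerZl; have := inner_posdef u0; nra.
have big_a : (2 < \dim (hop_eigenspace f a))%N -> 0 <= a.
  move=> dim2; have [||u [u0 uE ou]] := corth_of_dim_gt2 _ dim2 pf.1.
  - by move=> y; apply: hop_eigenspaceJ.
  - by rewrite mem_hop_eigenspace pf.2.
  have := secmin u ou; move: uE; rewrite mem_hop_eigenspace => /eqP ->.
  by rewrite innerZl; have := inner_posdef u0; nra.
have ra : a < 0 -> complex_rank_one (H := H) a.
  move=> a0'; apply: (rank_one_of_dim hO pf.1).
  by rewrite leqNgt; apply/negP => /big_a; rewrite leNgt a0'.
(* Here a < 0 has complex multiplicity 1, so f and a take over the roles of e and b. *)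
have caseb : b = 0 -> exists b e,
  [/\ quadratic_relation (H := H) 0 b, complex_rank_one (H := H) b,
      principal b e & b != 0].
  move=> b00; have a0' : a < 0 by rewrite -b00.
  exists a, f; split=> //; [|exact: ra|by rewrite lt_eqF].
  by rewrite -b00; apply: quadratic_relation_sym.
have [dle|dgt] := leqP (\dim (hop_eigenspace e b)) 2.
  have rb := rank_one_of_dim hO pe.1 dle.
  have [a00|] := principal_dichotomy hs hO spec ab rb pe; last exact: caseb.
  by exists b, e; split=> //; rewrite -a00 // gt_eqF.
(* Now a < b <= 0, so a has multiplicity 1 and the dichotomy at f leaves only b = 0. *)
have b_le0 := big_b dgt; have a_lt0 : a < 0 by exact: lt_le_trans ltab b_le0.
have [|a00] := principal_dichotomy hs hO spec' ba (ra a_lt0) pf.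
  exact: caseb.
by rewrite a00 ltxx in a_lt0.
Qed.

End Osserman.

(** * Components of the model *)

Section ModelComponents.
Context {R : realType} (mu : R) (m : nat).
Implicit Types (a b c d : idx m).

Definition re_pairing a b : R :=
  (a.1 == b.1)%:R * (if a.2 == b.2 then (-1) ^+ a.2 else 0).
Definition im_pairing a b : R := (a.1 == b.1)%:R * (a.2 != b.2)%:R.

(* [re_pairing] and [im_pairing] are the real and the imaginary part of the
   complex bilinear form in which x_1, ..., x_m are orthonormal. *)
Definition flat_comp a b c d : R := mu / 2 *
  (re_pairing a c * re_pairing b d + im_pairing a c * im_pairing b d -
   (re_pairing a d * re_pairing b c + im_pairing a d * im_pairing b c)).

Lemma re_pairingC a b : re_pairing a b = re_pairing b a.
Proof.
rewrite /re_pairing (eq_sym b.1) (eq_sym b.2).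
by case: (a.2 =P b.2) => // ->.
Qed.

Lemma im_pairingC a b : im_pairing a b = im_pairing b a.
Proof. by rewrite /im_pairing (eq_sym b.1) (eq_sym b.2). Qed.

Lemma flat_comp_asym a b c d : flat_comp a b c d = - flat_comp b a c d.
Proof. by rewrite /flat_comp; ring. Qed.

Lemma flat_comp_pair a b c d : flat_comp a b c d = flat_comp c d a b.
Proof.
rewrite /flat_comp !(re_pairingC c) !(re_pairingC d).
by rewrite !(im_pairingC c) !(im_pairingC d); ring.
Qed.

Lemma flat_comp_list q v : (q, v) \in C_list mu m ->
  flat_comp q.1.1.1 q.1.1.2 q.1.2 q.2 = v.
Proof.
rewrite mem_cat => /orP[/flatten_mapP[i _]|/flatten_mapP[[i j]]].
  rewrite inE => /eqP[-> ->].
  by rewrite /flat_comp /re_pairing /im_pairing /= eqxx /=; field.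
rewrite mem_filter /= => /andP[ij _].
have ji : j != i by rewrite eq_sym.
rewrite !inE => /or4P[||| /or3P[]] /eqP[-> ->];
  rewrite /flat_comp /re_pairing /im_pairing /= ?eqxx ?(negbTE ij) ?(negbTE ji);
  by rewrite /=; ring.
Qed.

Lemma flat_comp_full a b c d v : ((a, b, c, d), v) \in C_full mu m ->
  flat_comp a b c d = v.
Proof.
have A2 a' b' c' d' : flat_comp a' b' c' d' = - flat_comp a' b' d' c'.
  by rewrite flat_comp_pair flat_comp_asym flat_comp_pair.
move=> /flatten_mapP[[[[[a' b'] c'] d'] v'] /flat_comp_list /= <-].
rewrite !inE => /or4P[|||/or4P[||| /orP[]]] /eqP[-> -> -> -> ->] //.
- by rewrite flat_comp_asym.
- by rewrite flat_comp_asym A2 opprK.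
- by rewrite flat_comp_pair.
- by rewrite A2 flat_comp_pair.
- by rewrite flat_comp_asym flat_comp_pair.
- by rewrite flat_comp_asym A2 opprK flat_comp_pair.
Qed.

Local Notation support := [seq e.1 | e <- C_full mu m].

Lemma support_diag i q :
  q \in [seq e.1 | e <- flatten [seq Z2_orbit e | e <- C_diag mu i]] ->
  q \in support.
Proof.
move=> /mapP[x /flatten_mapP[e ei xe] ->]; apply: map_f.
apply/flatten_mapP; exists e => //; rewrite mem_cat; apply/orP; left.
by apply/flatten_mapP; exists i; rewrite ?mem_enum.
Qed.

Lemma support_off i j q : i != j ->
  q \in [seq e.1 | e <- flatten [seq Z2_orbit e | e <- C_off mu i j]] ->
  q \in support.
Proof.
move=> ij /mapP[x /flatten_mapP[e ei xe] ->]; apply: map_f.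
apply/flatten_mapP; exists e => //; rewrite mem_cat; apply/orP; right.
by apply/flatten_mapP; exists (i, j) => //; rewrite mem_filter /= ij mem_enum.
Qed.

Local Ltac mem_explicit := rewrite /=; solve [repeat (rewrite in_cons;
  apply/orP; first [left; apply/eqP; reflexivity | right])].

Lemma flat_comp_support a b c d :
  (a, b, c, d) \notin support -> flat_comp a b c d = 0.
Proof.
move=> ns; have [//|sup] : flat_comp a b c d = 0 \/ (a, b, c, d) \in support.
  2: by rewrite sup in ns.
case: a b c d {ns} => [i s] [j t] [k u] [l v].
rewrite /flat_comp /re_pairing /im_pairing /=.
have [<-|ik] := eqVneq i k; have [<-|jl] := eqVneq j l.
- have [<-|ij] := eqVneq i j.
    case: s; case: t; case: u; case: v => /=; try (by left; ring);
      right; apply: (@support_diag i); by mem_explicit.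
  case: s; case: t; case: u; case: v => /=; try (by left; ring); right;
    first [by apply: (support_off ij); mem_explicit
          | by rewrite eq_sym in ij; apply: (support_off ij);
               mem_explicit].
- left; have [il|_] := eqVneq i l; last by rewrite /=; ring.
  by rewrite il (negbTE jl) /=; ring.
- left; have [kj|_] := eqVneq j k; last by rewrite /=; ring.
  by rewrite -kj in ik; rewrite (negbTE ik) /=; ring.
have [li|_] := eqVneq l i; last by left; rewrite /=; ring.
have [kj|_] := eqVneq k j; last by left; rewrite /=; ring.
subst l k.
have [ij|ij] := eqVneq i j; first by rewrite ij eqxx in ik.
case: s; case: t; case: u; case: v => /=; try (by left; ring); right;
  first [by apply: (support_off ij); mem_explicit
        | by rewrite eq_sym in ij; apply: (support_off ij);
             mem_explicit].
Qed.

(** The table and the closed form agree on the listed components, and both vanish elsewhere. *)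
Lemma C_compE a b c d : C_comp mu a b c d = flat_comp a b c d.
Proof.
have [/mapP[[q v] qv /= qE]|ns] := boolP ((a, b, c, d) \in support).
  by rewrite -qE in qv; rewrite (C_compP qv) (flat_comp_full qv).
by rewrite C_comp0 // flat_comp_support.
Qed.

End ModelComponents.

(** * Real structures and isomorphism with the model *)

Section RealStructure.
Context {R : realType} {H : ah_model R} (hK : kahler H).
Context (tau : H -> H) (mu : R).
Context (tauD : forall x y, tau (x + y) = tau x + tau y).
Context (tauZ : forall k x, tau (k *: x) = k *: tau x).
Context (tauJ : forall x, tau (cstr x) = - cstr (tau x)).
Context (tau_sym : forall x y, inner (tau x) y = inner x (tau y)).
Context (tauK : forall x, tau (tau x) = x).
Context (flat : forall x y z w, kform x y z w = mu *
  (inner (tau x) y * inner (tau z) w +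
   inner (cstr (tau x)) y * inner (cstr (tau z)) w)).

(** J sends fixed vectors of [tau] to its eigenvalue -1, and [tau] is symmetric. *)
Lemma fixed_inner_cstr x y : tau x = x -> tau y = y -> inner (cstr x) y = 0.
Proof.
move=> tx ty; suff : inner (cstr x) y = - inner (cstr x) y by lra.
by rewrite -{1}ty -tau_sym tauJ tx innerNl.
Qed.

Lemma fixed_decomposition x : exists y w,
  [/\ tau y = y, tau w = w & x = y + cstr w].
Proof.
(* These are the tau-invariant part of x and -J applied to its anti-invariant part. *)
exists (2^-1 *: (x + tau x)), (- (2^-1 *: cstr (x - tau x))); split.
- by rewrite tauZ tauD tauK (addrC x).
- have tN y : tau (- y) = - tau y by rewrite -scaleN1r tauZ scaleN1r.
  by rewrite tN tauZ tauJ tauD tN tauK -cstrN opprB.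
by rewrite cstrN cstrZ cstr_sqr; apply: inner_inj => w; rewrite !innerE; field.
Qed.

Lemma fixed_orthonormal_basis : exists m (e : 'I_m -> H),
  [/\ orthonormal_family e, forall i, tau (e i) = e i & forall x,
      x = \sum_i inner x (e i) *: e i +
          \sum_i inner x (cstr (e i)) *: cstr (e i)].
Proof.
have ltau : linear tau by move=> k x y; rewrite tauD tauZ.
pose U := lker (linfun tau - \1%VF).
have UE x : x \in U -> tau x = x.
  rewrite memv_ker add_lfunE opp_lfunE id_lfunE linfun_linE // subr_eq0.
  by move/eqP.
have UI x : tau x = x -> x \in U.
  by move=> tx; rewrite memv_ker add_lfunE opp_lfunE id_lfunE linfun_linE //
    tx subrr.
have [m [e [oe eU eB]]] := orthonormal_basis U.
have te i : tau (e i) = e i by apply: UE.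
exists m, e; split=> // x; have [y [w [ty tw ->]]] := fixed_decomposition x.
have E : y + cstr w = \sum_i inner y (e i) *: e i +
    \sum_i inner w (e i) *: cstr (e i).
  rewrite {1}(eB y) ?UI //; congr (_ + _); rewrite {1}(eB w) ?UI // linear_sum.
  by apply: eq_bigr => i _; rewrite /= linearZ.
rewrite {1}E; congr (_ + _); apply: eq_bigr => i _; congr (_ *: _);
  rewrite innerDl.
  by rewrite (fixed_inner_cstr tw) // addr0.
by rewrite cstr_isom (inner_sym y) (fixed_inner_cstr _ ty) // add0r.
Qed.

(** * Coordinates in an orthonormal frame of the real form *)

Section Coordinates.
Context (m : nat) (e : 'I_m -> H) (oe : orthonormal_family e).
Context (te : forall i, tau (e i) = e i).
Context (eB : forall x, x = \sum_i inner x (e i) *: e i +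
                        \sum_i inner x (cstr (e i)) *: cstr (e i)).

Definition real_frame (a : idx m) : H :=
  if a.2 then cstr (e a.1) else e a.1.

Lemma real_frame_sum x : x = \sum_a inner x (real_frame a) *: real_frame a.
Proof.
rewrite {1}(eB x) -big_split /=.
rewrite (eq_bigr (fun i => \sum_s inner x (real_frame (i, s)) *:
                            real_frame (i, s))); last first.
  by move=> i _; rewrite big_bool addrC.
by rewrite pair_bigA; apply: eq_bigr => -[].
Qed.

Lemma real_frame_tau a b :
  inner (tau (real_frame a)) (real_frame b) = re_pairing a b /\
  inner (cstr (tau (real_frame a))) (real_frame b) = im_pairing a b.
Proof.
case: a b => [i s] [j t]; rewrite /real_frame /re_pairing /im_pairing /=.
have Je := fixed_inner_cstr (te i) (te j).
have Je' := fixed_inner_cstr (te j) (te i).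
case: s; case: t => /=;
  rewrite ?tauJ ?te ?cstrN ?cstr_sqr ?opprK ?innerNl ?cstr_isom ?oe
          ?(inner_sym (e i) (cstr _)) ?Je ?Je' ?expr0 ?expr1; split; ring.
Qed.

(** In the frame Q is mu times products of the pairings; halving its antisymmetrization gives the
    factor mu / 2 of the closed form. *)
Lemma curv_real_frame a b c d :
  curv (real_frame a) (real_frame b) (real_frame c) (real_frame d) =
  C_comp mu a b c d.
Proof.
rewrite C_compE /flat_comp.
have := curv_kform hK (real_frame c) (real_frame a) (real_frame b) (real_frame d).
rewrite !flat !(real_frame_tau _ _).1 !(real_frame_tau _ _).2.
rewrite (re_pairingC c) (im_pairingC c) (re_pairingC d) (im_pairingC d) => E.
apply: (@mulfI _ 2); first by rewrite pnatr_eq0.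
by rewrite E; field.
Qed.

Lemma isomorphic_C_model : isomorphic H (C_model mu m).
Proof.
pose f x : C_model mu m :=
  (\row_i inner x (e i), \row_i inner x (cstr (e i))).
have lf : linear f.
  move=> k x y; rewrite /f; congr (_, _); apply/rowP => i;
  by rewrite !mxE !innerE.
pose F := linfun (HB.pack_for {linear H -> C_model mu m} f
  (GRing.isLinear.Build _ _ _ _ f lf)).
have FE x : F x = f x by rewrite lfunE.
have coordF a x : C_coord a (F x) = inner x (real_frame a).
  by rewrite FE /C_coord /f /real_frame; case: a.2; rewrite mxE.
exists F; split.
- exists (fun p : C_model mu m => comb e p.1 + cstr (comb e p.2)) => [x|[u v]].
    rewrite FE /= [RHS]eB /comb linear_sum /=; congr (_ + _);
    by apply: eq_bigr => i _; rewrite mxE /= ?linearZ.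
  have tc w : tau (comb e w) = comb e w.
    apply: inner_inj => z; rewrite tau_sym !inner_comb.
    by apply: eq_bigr => i _; rewrite -tau_sym te.
  rewrite FE /f /=; congr (_, _); apply/rowP => i; rewrite mxE innerDl.
    by rewrite inner_combE // fixed_inner_cstr // addr0.
  rewrite cstr_isom inner_combE // inner_sym fixed_inner_cstr //.
  by rewrite add0r.
- move=> x y; rewrite [LHS]/= /C_inner [in RHS](real_frame_sum x).
  rewrite (scalar_form_sum _ (inner_scalarl y)); apply: eq_bigr => a _.
  by rewrite !coordF innerZl (inner_sym y).
- move=> x; rewrite /= C_cstrE !FE /f; congr (_, _); apply/rowP => i;
  by rewrite !mxE ?cstr_isom // innerJ.
move=> x y z w; rewrite [LHS]/= /C_curv.
rewrite [in RHS](real_frame_sum x) (scalar_form_sum _ (curv_scalar1 _ _ _)).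
apply: eq_bigr => a _; rewrite (scalar_formZ _ _ (curv_scalar1 _ _ _)).
rewrite [in RHS](real_frame_sum y).
rewrite (scalar_form_sum _ (curv_scalar2 _ _ _)) mulr_sumr.
apply: eq_bigr => b _; rewrite (scalar_formZ _ _ (curv_scalar2 _ _ _)).
rewrite [in RHS](real_frame_sum z).
rewrite (scalar_form_sum _ (curv_scalar3 _ _ _)) !mulr_sumr.
apply: eq_bigr => c _; rewrite (scalar_formZ _ _ (curv_scalar3 _ _ _)).
rewrite [in RHS](real_frame_sum w).
rewrite (scalar_form_sum _ (curv_scalar4 _ _ _)) !mulr_sumr.
apply: eq_bigr => d _; rewrite (scalar_formZ _ _ (curv_scalar4 _ _ _)).
by rewrite curv_real_frame !coordF; ring.
Qed.

End Coordinates.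

Lemma isomorphic_mdim (K : ah_model R) : isomorphic H K -> mdim H = mdim K.
Proof.
move=> [f [[g fK gK] _ _ _]]; rewrite /mdim.
have kf : lker f = 0%VS.
  apply/eqP; rewrite -subv0; apply/subvP => x; rewrite memv_ker memv0.
  by move=> /eqP fx; rewrite -(fK x) fx -(linear0 f) fK.
rewrite -(limg_dim_eq (f := f) (U := fullv)) ?kf ?capv0 //.
by congr (\dim _); apply/vspaceP => y; rewrite memvf -(gK y) memv_img ?memvf.
Qed.

Lemma isomorphic_C_model_half : exists m, isomorphic H (C_model mu m).
Proof.
have [m [e [oe te eB]]] := fixed_orthonormal_basis.
by exists m; apply: isomorphic_C_model te eB.
Qed.

End RealStructure.

Theorem theorem1p8 (R : realType) (n : nat) (hn : (4 <= n)%N)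
    (H : ah_model R) (hdim : mdim H = n)
    (hK : kahler H) (hO : complex_osserman H) (h2 : two_eigenvalues H)
    (hs : ~ const_hol_sec H) :
  exists mu : R, isomorphic H (C_model mu n./2).
Proof.
have nz : {: H}%VS != 0%VS.
  by rewrite -dimv_eq0 -lt0n -/(mdim H) hdim (leq_trans _ hn).
have [b [e [q0b rb pe b0]]] := flat_principal_exists hK hs hO h2 nz.
have [m iso] : exists m, isomorphic H (C_model b m).
  apply: (isomorphic_C_model_half hK (tau := conjugation b e)).
  - exact: conjugationD.
  - exact: conjugationZ.
  - exact: conjugationJ.
  - exact: conjugation_sym.
  - exact: conjugationK.
  - exact: kform_flat.
(* The m found here is the size of the real frame; comparing dimensions gives n = 2m. *)
exists b; suff -> : n./2 = m by [].
by rewrite -hdim (isomorphic_mdim iso) mdim_C_model mul2n doubleK.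
Qed.
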